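(* There exists a family of statistics $\tau=(\tau_n)_{n\ge1}$, $\tau_n:\{0,1\}^n\to\mathbb{R}$, such that for every stationary ergodic probability measure $\nu$ on infinite binary sequences, with $\nu$-probability $1$, $$\lim_{n\to\infty} -\frac{1}{n}\log_2 \pi_{\tau}(x_1\ldots x_n) = 1-h(\nu),$$ where $h(\nu)$ is the Shannon entropy (entropy rate) of $\nu$ and $$\pi_\tau(x_1\ldots x_n)=\frac{\bigl|\{\,y\in\{0,1\}^n:\tau_n(y)>\tau_n(x_1\ldots x_n)\,\}\bigr|}{2^n}.$$
   Context: $\pi_\tau$ is the p-value of the test based on statistic $\tau$ for the null hypothesis that $x_1\ldots x_n$ is uniformly distributed on $\{0,1\}^n$. Logarithms are base 2; $h(\nu)=\lim_{n\to\infty}-\frac1n\sum_{x\in\{0,1\}^n}\nu(x)\log_2\nu(x)$. (In the paper the statistic is $\tau_n(x_1\ldots x_n)=n-|\phi(x_1\ldots x_n)|$, where $\phi$ is a universal code: for each $m$, $\phi$ is an injective map $\{0,1\}^m\to\bigcup_{i\ge1}\{0,1\}^i$ with $\sum_{u\in\{0,1\}^m}2^{-|\phi(u)|}=1$, and for every stationary ergodic $\nu$, $\frac1n|\phi(x_1\ldots x_n)|\to h(\nu)$ with $\nu$-probability 1.) *)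

(* Defs.v *)
From Stdlib Require Import Reals List.
Import ListNotations.
Open Scope R_scope.

(* Infinite binary sequences x = x_1 x_2 ... are functions nat -> bool
   (index 0 holds x_1). Finite words are lists of booleans, first letter first. *)
Definition bseq := nat -> bool.

Definition prefix (x : bseq) (n : nat) : list bool := map x (seq 0 n).

Definition shift (x : bseq) : bseq := fun k => x (S k).

Fixpoint words (n : nat) : list (list bool) :=
  match n with
  | O => [[]]
  | S m => map (cons false) (words m) ++ map (cons true) (words m)
  end.

Definition sumR (l : list R) : R := fold_right Rplus 0 l.

Definition log2 (x : R) : R := ln x / ln 2.

(* A probability measure on {0,1}^N, given by its values on cylinders [w]
   (Kolmogorov consistency; it extends uniquely to a Borel probability measure). *)
Definition prob_measure (nu : list bool -> R) : Prop :=
  nu [] = 1 /\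
  (forall w, 0 <= nu w) /\
  (forall w, nu w = nu (w ++ [false]) + nu (w ++ [true])).

(* shift invariance: nu(T^{-1}[w]) = nu([w]) *)
Definition stationary (nu : list bool -> R) : Prop :=
  forall w, nu w = nu (false :: w) + nu (true :: w).

Inductive borel : (bseq -> Prop) -> Prop :=
| borel_cyl (w : list bool) : borel (fun x => prefix x (length w) = w)
| borel_compl (A : bseq -> Prop) : borel A -> borel (fun x => ~ A x)
| borel_cunion (F : nat -> bseq -> Prop) :
    (forall i, borel (F i)) -> borel (fun x => exists i, F i x)
| borel_ext (A B : bseq -> Prop) : borel A -> (forall x, A x <-> B x) -> borel B.

Definition null (nu : list bool -> R) (A : bseq -> Prop) : Prop :=
  forall eps, 0 < eps ->
    exists c : nat -> list bool,
      (forall x, A x -> exists i, prefix x (length (c i)) = c i) /\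
      (forall k, sumR (map (fun i => nu (c i)) (seq 0 k)) <= eps).

Definition almost_surely (nu : list bool -> R) (P : bseq -> Prop) : Prop :=
  null nu (fun x => ~ P x).

Definition ergodic (nu : list bool -> R) : Prop :=
  forall A : bseq -> Prop, borel A ->
    (forall x, A x <-> A (shift x)) ->
    null nu A \/ null nu (fun x => ~ A x).

Definition xlog2x (p : R) : R := if Req_EM_T p 0 then 0 else p * log2 p.
Definition block_entropy_rate (nu : list bool -> R) (n : nat) : R :=
  - / INR n * sumR (map (fun w => xlog2x (nu w)) (words n)).

Definition pvalue (tau : nat -> list bool -> R) (n : nat) (u : list bool) : R :=
  INR (length (filter (fun y => if Rlt_dec (tau n u) (tau n y) then true else false)
                      (words n))) / 2 ^ n.

(* Main.v *)
Require Import Defs.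
From Stdlib Require Import Reals List Lra Lia Arith Cantor FinFun Classical ClassicalEpsilon.
Import ListNotations.
Open Scope R_scope.

(** Words of length [n] are ranked by decreasing value of a mixture of countably many codes.  Up to
    constants, the number of words ranked above [u] is at most the inverse of the weight of [u]
    under any one of these codes, which gives the upper bound on the rank once the codes reach the
    entropy; the lower bound holds because few words have a small rank, and a family of at most
    [2^(c n)] words with [c < h] is almost surely visited finitely often.

    Both halves rest on one tiling lemma: if [Phi] is subadditive and almost every sequence has a
    prefix with [Phi <= c n], then cutting a long word greedily into such prefixes shows that the
    mean of [Phi] over [N]-words is at most [(c + eps) N + O(1)].  Applied to minus an occurrence
    count it gives the pointwise ergodic theorem for functions of finitely many coordinates, hence
    the upper bound.  Applied to the cost of a code whose tokens are the words of the small family,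
    it bounds the entropy by [c] if the family is visited infinitely often, by Gibbs' inequality.
    Ergodicity is used on exactly invariant sets only, which makes it possible to work with covers
    by cylinders and the compactness of Cantor space instead of measures of Borel sets. *)

(** * Sums over the words of a given length and over initial segments of [nat] *)

Fixpoint wsum (n : nat) (F : list bool -> R) : R :=
  match n with
  | O => F []
  | S m => wsum m (fun w => F (false :: w)) + wsum m (fun w => F (true :: w))
  end.

Lemma sumR_app l l' : sumR (l ++ l') = sumR l + sumR l'.
Proof. induction l as [|a l IH]; simpl; [lra | unfold sumR in *; rewrite IH; lra]. Qed.

Lemma sumR_words n F : sumR (map F (words n)) = wsum n F.
Proof.
  revert F; induction n as [|n IH]; intros F; simpl.
  - unfold sumR; simpl; lra.
  - rewrite map_app, sumR_app, !map_map, !IH; reflexivity.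
Qed.

Lemma words_length n w : In w (words n) <-> length w = n.
Proof.
  revert w; induction n as [|n IH]; intros w; simpl.
  - split; [intros [<-|[]]; reflexivity | destruct w; [now left | discriminate]].
  - rewrite in_app_iff, !in_map_iff; split.
    + intros [(v & <- & Hv)|(v & <- & Hv)]; simpl; f_equal; now apply IH.
    + destruct w as [|[] w]; [discriminate| |]; intros [= Hw]; apply IH in Hw; eauto.
Qed.

Lemma wsum_le n F G :
  (forall w, length w = n -> F w <= G w) -> wsum n F <= wsum n G.
Proof.
  revert F G; induction n as [|n IH]; intros F G H; simpl.
  - now apply H.
  - apply Rplus_le_compat; apply IH; intros w Hw; apply H; simpl; lia.
Qed.

Lemma wsum_ext n F G :
  (forall w, length w = n -> F w = G w) -> wsum n F = wsum n G.
Proof. intros H; apply Rle_antisym; apply wsum_le; intros w Hw; rewrite (H w Hw); lra. Qed.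

Lemma wsum_plus n F G : wsum n (fun w => F w + G w) = wsum n F + wsum n G.
Proof. revert F G; induction n as [|n IH]; intros F G; simpl; [|rewrite !IH]; lra. Qed.

Lemma wsum_scal n a F : wsum n (fun w => a * F w) = a * wsum n F.
Proof. revert F; induction n as [|n IH]; intros F; simpl; [|rewrite !IH]; lra. Qed.

Lemma wsum_const n a : wsum n (fun _ => a) = 2 ^ n * a.
Proof. induction n as [|n IH]; simpl; [|rewrite IH]; lra. Qed.

Lemma wsum_nonneg n F : (forall w, length w = n -> 0 <= F w) -> 0 <= wsum n F.
Proof.
  intros H; replace 0 with (wsum n (fun _ => 0)) by (rewrite wsum_const; lra).
  now apply wsum_le.
Qed.

Lemma wsum_app n m F :
  wsum (n + m) F = wsum n (fun u => wsum m (fun v => F (u ++ v))).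
Proof. revert F; induction n as [|n IH]; intros F; simpl; [|rewrite !IH]; reflexivity. Qed.

Lemma wsum_ge_term n F w :
  (forall v, length v = n -> 0 <= F v) -> length w = n -> F w <= wsum n F.
Proof.
  revert F w; induction n as [|n IH]; intros F w H Hw; simpl.
  - destruct w; [lra | discriminate].
  - destruct w as [|a w]; [discriminate|]; injection Hw as Hw.
    assert (H0 : forall a, 0 <= wsum n (fun v => F (a :: v)))
      by (intros b; apply wsum_nonneg; intros v Hv; apply H; simpl; lia).
    assert (H1 : F (a :: w) <= wsum n (fun v => F (a :: v)))
      by (apply (IH (fun v => F (a :: v))); [intros v Hv; apply H; simpl; lia | easy]).
    pose proof (H0 false); pose proof (H0 true); destruct a; lra.
Qed.

Lemma wsum_filter n (p : list bool -> bool) :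
  INR (length (filter p (words n))) = wsum n (fun w => if p w then 1 else 0).
Proof.
  rewrite <- sumR_words; induction (words n) as [|w l IH]; [reflexivity|].
  simpl filter; simpl map; unfold sumR in *; simpl fold_right; rewrite <- IH.
  destruct (p w); [simpl length; rewrite S_INR|]; lra.
Qed.

Fixpoint bsum (n : nat) (f : nat -> R) : R :=
  match n with O => 0 | S m => bsum m f + f m end.

Lemma sumR_seq n f : sumR (map f (seq 0 n)) = bsum n f.
Proof.
  induction n as [|n IH]; [reflexivity|].
  rewrite seq_S, map_app, sumR_app, IH; simpl; unfold sumR; simpl; lra.
Qed.

Lemma bsum_le n f g : (forall i, (i < n)%nat -> f i <= g i) -> bsum n f <= bsum n g.
Proof.
  induction n as [|n IH]; intros H; simpl; [lra|].
  apply Rplus_le_compat; [apply IH; intros i Hi|]; apply H; lia.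
Qed.

Lemma bsum_ext n f g : (forall i, (i < n)%nat -> f i = g i) -> bsum n f = bsum n g.
Proof. intros H; apply Rle_antisym; apply bsum_le; intros i Hi; rewrite (H i Hi); lra. Qed.

Lemma bsum_plus n f g : bsum n (fun i => f i + g i) = bsum n f + bsum n g.
Proof. induction n as [|n IH]; simpl; [|rewrite IH]; lra. Qed.

Lemma bsum_const n a : bsum n (fun _ => a) = INR n * a.
Proof. induction n as [|n IH]; [simpl; lra|]. cbn [bsum]; rewrite IH, S_INR; lra. Qed.

Lemma bsum_nonneg n f : (forall i, (i < n)%nat -> 0 <= f i) -> 0 <= bsum n f.
Proof.
  intros H; replace 0 with (bsum n (fun _ => 0)) by (rewrite bsum_const; lra).
  now apply bsum_le.
Qed.

Lemma bsum_ge_term n f i :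
  (forall j, (j < n)%nat -> 0 <= f j) -> (i < n)%nat -> f i <= bsum n f.
Proof.
  induction n as [|n IH]; intros H Hi; simpl; [lia|].
  destruct (Nat.eq_dec i n) as [->|Hn].
  - assert (0 <= bsum n f) by (apply bsum_nonneg; intros j Hj; apply H; lia); lra.
  - assert (f i <= bsum n f) by (apply IH; [intros j Hj; apply H|]; lia).
    assert (0 <= f n) by (apply H; lia); lra.
Qed.

Lemma bsum_S_first n f : bsum (S n) f = f O + bsum n (fun i => f (S i)).
Proof.
  induction n as [|n IH]; [simpl; lra|].
  change (bsum (S n) f + f (S n) = f O + (bsum n (fun i => f (S i)) + f (S n))).
  rewrite IH; lra.
Qed.

Lemma wsum_bsum n k F : wsum n (fun w => bsum k (fun i => F i w)) = bsum k (fun i => wsum n (F i)).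
Proof.
  induction k as [|k IH]; simpl; [rewrite wsum_const; lra|].
  now rewrite wsum_plus, IH.
Qed.

Lemma bsum_half n : bsum n (fun i => (/ 2) ^ (S i)) = 1 - (/ 2) ^ n.
Proof. induction n as [|n IH]; [simpl; lra|]; cbn [bsum]; rewrite IH; simpl; lra. Qed.

Lemma bsum_scal n a f : bsum n (fun i => a * f i) = a * bsum n f.
Proof. induction n as [|n IH]; cbn [bsum]; [|rewrite IH]; lra. Qed.

(** * Null sets and compactness of Cantor space *)

Lemma prefix_length x n : length (prefix x n) = n.
Proof. unfold prefix; now rewrite length_map, length_seq. Qed.

Lemma prefix_S x n : prefix x (S n) = x O :: prefix (shift x) n.
Proof. unfold prefix, shift; simpl; now rewrite <- seq_shift, map_map. Qed.

Lemma prefix_S_last x n : prefix x (S n) = prefix x n ++ [x n].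
Proof. unfold prefix; now rewrite seq_S, map_app. Qed.

Lemma prefix_add x n m : prefix x (n + m) = prefix x n ++ map x (seq n m).
Proof. unfold prefix; now rewrite seq_app, map_app. Qed.

Lemma firstn_prefix x n m : (n <= m)%nat -> firstn n (prefix x m) = prefix x n.
Proof.
  intros H; replace m with (n + (m - n))%nat by lia; rewrite prefix_add.
  rewrite firstn_app, prefix_length, Nat.sub_diag, firstn_O, app_nil_r.
  now rewrite <- (prefix_length x n) at 1; rewrite firstn_all.
Qed.

Definition hit (P : list bool -> Prop) (w : list bool) : Prop :=
  exists n, (n <= length w)%nat /\ P (firstn n w).

Lemma hit_app P u v : hit P u -> hit P (u ++ v).
Proof.
  intros (n & Hn & H); exists n; rewrite length_app; split; [lia|].
  rewrite firstn_app; replace (n - length u)%nat with O by lia.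
  now rewrite firstn_O, app_nil_r.
Qed.

(** Koenig's lemma by contradiction: if no uniform bound exists at the empty word, then at each
    stage some one-letter extension has none either, and following these bad extensions yields a
    sequence that contradicts the bar. *)
Lemma bar_compact (P : list bool -> Prop) :
  (forall x, exists n, P (prefix x n)) ->
  exists M, forall w, (M <= length w)%nat -> hit P w.
Proof.
  intros bar.
  set (good := fun u => exists M, forall v, (M <= length v)%nat -> hit P (u ++ v)).
  destruct (classic (good [])) as [(M & HM)|bad].
  { exists M; intros w Hw; exact (HM w Hw). }
  exfalso.
  assert (step : forall u, ~ good u -> exists a, ~ good (u ++ [a])).
  { intros u Hu; apply NNPP; intros Hn.
    assert (G : forall a, good (u ++ [a])) by (intros a; apply NNPP; eauto).
    apply Hu; destruct (G false) as [M0 H0], (G true) as [M1 H1].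
    exists (S (M0 + M1)); intros [|a v] Hv; simpl in Hv; [lia|].
    change (a :: v) with ([a] ++ v); rewrite app_assoc.
    destruct a; [apply H1 | apply H0]; lia. }
  set (nxt := fun u => match excluded_middle_informative (~ good (u ++ [false])) with
                       | left _ => false | right _ => true end).
  assert (Hnxt : forall u, ~ good u -> ~ good (u ++ [nxt u])).
  { intros u Hu; unfold nxt; destruct (excluded_middle_informative _) as [H|H]; [easy|].
    destruct (step u Hu) as [[] Ha]; [easy | contradiction]. }
  set (path := fix path n := match n with O => [] | S m => path m ++ [nxt (path m)] end).
  set (x := fun n => nxt (path n)).
  assert (Hp : forall n, prefix x n = path n).
  { induction n as [|n IH]; [reflexivity|]; rewrite prefix_S_last, IH; reflexivity. }
  assert (Hb : forall n, ~ good (path n)).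
  { induction n as [|n IH]; [exact bad|]; simpl; now apply Hnxt. }
  destruct (bar x) as [n Hn]; apply (Hb n); exists O; intros v _.
  apply hit_app; exists n; rewrite <- Hp, prefix_length; split; [lia|].
  now rewrite firstn_prefix.
Qed.

Lemma null_incl nu (A B : bseq -> Prop) :
  (forall x, B x -> A x) -> null nu A -> null nu B.
Proof. intros H N eps He; destruct (N eps He) as (c & Hc & Hs); exists c; split; eauto. Qed.

Lemma sumR_incl (T : Type) (g : T -> R) (l l' : list T) :
  (forall t, 0 <= g t) -> NoDup l -> incl l l' -> sumR (map g l) <= sumR (map g l').
Proof.
  intros Hg; revert l'; induction l as [|a l IH]; intros l' Hd Hi; unfold sumR in *; simpl.
  - clear Hi; induction l' as [|b l' IH']; simpl; [lra | specialize (Hg b); lra].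
  - inversion Hd as [|? ? Ha Hd']; subst.
    destruct (in_split a l') as (l1 & l2 & ->); [apply Hi; now left|].
    assert (H : fold_right Rplus 0 (map g l) <= fold_right Rplus 0 (map g (l1 ++ l2))).
    { apply IH; [easy|]; intros t Ht; assert (Ht' := Hi t (or_intror Ht)).
      rewrite in_app_iff in *; simpl in Ht'.
      destruct Ht' as [|[->|]]; [now left | contradiction | now right]. }
    rewrite !map_app in *; simpl.
    change (g a + sumR (map g l) <= sumR (map g l1 ++ g a :: map g l2)).
    change (sumR (map g l) <= sumR (map g l1 ++ map g l2)) in H.
    rewrite sumR_app in *; unfold sumR at 3; simpl; fold (sumR (map g l2)); lra.
Qed.

Lemma sumR_list_prod g (l l' : list nat) :
  sumR (map g (list_prod l l')) = sumR (map (fun i => sumR (map (fun j => g (i, j)) l')) l).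
Proof.
  induction l as [|i l IH]; [reflexivity|].
  simpl; rewrite map_app, sumR_app, IH, map_map; reflexivity.
Qed.

(** The [i]-th set receives the share [eps / 2^(i+1)], and the covers are interleaved along the
    Cantor pairing, whose first [k] pairs lie in a [k] by [k] square. *)
Lemma null_countable_union nu (A : nat -> bseq -> Prop) :
  (forall w, 0 <= nu w) -> (forall i, null nu (A i)) -> null nu (fun x => exists i, A i x).
Proof.
  intros Hnu HA eps He.
  assert (He' : forall i, 0 < eps * (/ 2) ^ S i)
    by (intros i; apply Rmult_lt_0_compat; [easy | apply pow_lt; lra]).
  set (c := fun i => proj1_sig (constructive_indefinite_description _ (HA i _ (He' i)))).
  assert (Hc : forall i, (forall x, A i x -> exists j, prefix x (length (c i j)) = c i j) /\
                         forall k, sumR (map (fun j => nu (c i j)) (seq 0 k)) <= eps * (/ 2) ^ S i)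
    by (intros i; unfold c; apply proj2_sig).
  exists (fun n => c (fst (of_nat n)) (snd (of_nat n))); split.
  - intros x [i Hi]; destruct (proj1 (Hc i) x Hi) as [j Hj].
    exists (to_nat (i, j)); now rewrite cancel_of_to.
  - intros k.
    replace (map _ (seq 0 k)) with
      (map (fun p => nu (c (fst p) (snd p))) (map of_nat (seq 0 k))) by now rewrite map_map.
    apply Rle_trans with (sumR (map (fun p => nu (c (fst p) (snd p)))
                                (list_prod (seq 0 k) (seq 0 k)))).
    + apply sumR_incl; [intros; apply Hnu| |].
      * apply FinFun.Injective_map_NoDup; [|apply seq_NoDup].
        intros a b H; rewrite <- (cancel_to_of a), <- (cancel_to_of b); now rewrite H.
      * intros [i j] H; apply in_map_iff in H as (n & Hn & Hin); apply in_seq in Hin.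
        pose proof (to_nat_non_decreasing i j) as Hij.
        rewrite <- Hn, cancel_to_of in Hij.
        apply in_prod; apply in_seq; lia.
    + rewrite sumR_list_prod; simpl.
      rewrite sumR_seq.
      apply Rle_trans with (bsum k (fun i => eps * (/ 2) ^ S i)).
      * apply bsum_le; intros i _; apply Hc.
      * assert (E : bsum k (fun i => eps * (/ 2) ^ S i) = eps * (1 - (/ 2) ^ k)).
        { now rewrite bsum_scal, bsum_half. }
        rewrite E; assert (0 < (/ 2) ^ k) by (apply pow_lt; lra); nra.
Qed.

Lemma as_impl nu (P Q : bseq -> Prop) :
  (forall x, P x -> Q x) -> almost_surely nu P -> almost_surely nu Q.
Proof. intros H; apply null_incl; intros x HQ HP; auto. Qed.

Lemma as_forall nu (P : nat -> bseq -> Prop) :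
  (forall w, 0 <= nu w) -> (forall i, almost_surely nu (P i)) ->
  almost_surely nu (fun x => forall i, P i x).
Proof.
  intros Hnu H; apply null_incl with (fun x => exists i, ~ P i x).
  - intros x Hx; now apply not_all_ex_not.
  - now apply null_countable_union.
Qed.

Lemma as_and nu (P Q : bseq -> Prop) :
  (forall w, 0 <= nu w) -> almost_surely nu P -> almost_surely nu Q ->
  almost_surely nu (fun x => P x /\ Q x).
Proof.
  intros Hnu HP HQ.
  apply as_impl with (fun x => forall i : nat, match i with O => P x | _ => Q x end).
  - intros x H; exact (conj (H O) (H 1%nat)).
  - apply as_forall; [easy|]; now intros [|i].
Qed.

(** * Indicators and masses of sets of words *)

Definition indic (P : Prop) : R := if excluded_middle_informative P then 1 else 0.

Lemma indic_true (P : Prop) : P -> indic P = 1.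
Proof. intros H; unfold indic; now destruct (excluded_middle_informative P). Qed.

Lemma indic_false (P : Prop) : ~ P -> indic P = 0.
Proof. intros H; unfold indic; now destruct (excluded_middle_informative P). Qed.

Lemma indic_bound (P : Prop) : 0 <= indic P <= 1.
Proof. unfold indic; destruct (excluded_middle_informative P); lra. Qed.

Lemma indic_iff (P Q : Prop) : (P <-> Q) -> indic P = indic Q.
Proof.
  intros H; destruct (classic P); [rewrite !indic_true | rewrite !indic_false]; tauto.
Qed.

Lemma wsum_delta g u : wsum (length u) (fun w => g w * indic (w = u)) = g u.
Proof.
  revert g; induction u as [|a u IH]; intros g; simpl.
  - rewrite indic_true by easy; lra.
  - assert (E : forall b, wsum (length u) (fun w => g (b :: w) * indic (b :: w = a :: u)) =
                          if Bool.eqb a b then g (a :: u) else 0).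
    { intros b; destruct (Bool.eqb a b) eqn:Hab.
      - apply Bool.eqb_prop in Hab as <-; rewrite <- (IH (fun w => g (a :: w))).
        apply wsum_ext; intros w _; f_equal; apply indic_iff; split; congruence.
      - apply Bool.eqb_false_iff in Hab.
        rewrite (wsum_ext _ _ (fun _ => 0)); [rewrite wsum_const; lra|].
        intros w _; rewrite indic_false; [lra | congruence]. }
    rewrite !E; destruct a; simpl; lra.
Qed.

Lemma cylinder_mass nu u m :
  prob_measure nu -> wsum m (fun v => nu (u ++ v)) = nu u.
Proof.
  intros (_ & _ & H); revert u; induction m as [|m IH]; intros u; simpl.
  - now rewrite app_nil_r.
  - rewrite (H u), <- (IH (u ++ [false])), <- (IH (u ++ [true])).
    f_equal; apply wsum_ext; intros w _; now rewrite <- app_assoc.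
Qed.

Lemma total_mass nu m : prob_measure nu -> wsum m nu = 1.
Proof.
  intros H; transitivity (nu []); [exact (cylinder_mass nu [] m H) | apply H].
Qed.

Lemma wsum_firstn nu m n g :
  prob_measure nu -> (m <= n)%nat ->
  wsum n (fun w => nu w * g (firstn m w)) = wsum m (fun w => nu w * g w).
Proof.
  intros Hnu Hmn; replace n with (m + (n - m))%nat by lia; rewrite wsum_app.
  apply wsum_ext; intros u Hu; rewrite <- (cylinder_mass nu u (n - m) Hnu).
  rewrite Rmult_comm, <- wsum_scal; apply wsum_ext; intros v Hv.
  rewrite firstn_app, Hu, Nat.sub_diag, firstn_O, app_nil_r, <- Hu, firstn_all; lra.
Qed.

(** This replaces continuity of the measure along increasing open sets. Cylinders of total mass at
    most [d] cover the complement of [A]; with [P] they form a bar, so by compactness every word of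
    some length [M] without a prefix in [P] begins with a covering word. *)
Lemma full_open nu (A : bseq -> Prop) (P : list bool -> Prop) d :
  prob_measure nu -> almost_surely nu A ->
  (forall x, A x -> exists n, P (prefix x n)) -> 0 < d ->
  exists M, wsum M (fun w => nu w * indic (~ hit P w)) <= d.
Proof.
  intros Hnu HA HP Hd; destruct (HA d Hd) as (c & Hc & Hs).
  destruct (bar_compact (fun w => P w \/ exists i, c i = w)) as [M HM].
  { intros x; destruct (classic (A x)) as [Hx|Hx].
    - destruct (HP x Hx) as [n Hn]; eauto.
    - destruct (Hc x Hx) as [i Hi]; exists (length (c i)); eauto. }
  set (cov := fun i w => (length (c i) <= length w)%nat /\ firstn (length (c i)) w = c i).
  assert (Hcov : forall w, length w = M -> ~ hit P w -> exists i, cov i w).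
  { intros w Hw Hn; destruct (HM w) as (n & Hnw & [H|[i Hi]]); [lia| |].
    - exfalso; apply Hn; exists n; auto.
    - assert (length (c i) = n) by (rewrite Hi, length_firstn; lia).
      exists i; split; [lia|]; now rewrite H. }
  (* [null] bounds finite partial sums, so finitely many covering words have to serve all words of
     length [M]. *)
  assert (HI : exists I, forall w, length w = M -> ~ hit P w -> exists i, (i < I)%nat /\ cov i w).
  { assert (G : forall l, (forall w, In w l -> length w = M) ->
              exists I, forall w, In w l -> ~ hit P w -> exists i, (i < I)%nat /\ cov i w).
    { induction l as [|v l IH]; intros Hl; [exists O; intros w []|].
      destruct IH as [I HI]; [intros w Hw; apply Hl; now right|].
      destruct (classic (hit P v)) as [Hv|Hv].
      - exists I; intros w [->|Hw] Hn; [contradiction | auto].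
      - destruct (Hcov v) as [i Hi]; [apply Hl; now left | easy |].
        exists (I + S i)%nat; intros w [<-|Hw] Hn; [exists i; split; [lia|easy]|].
        destruct (HI w Hw Hn) as (j & Hj & Hj'); exists j; split; [lia | easy]. }
    destruct (G (words M)) as [I HI]; [intros w; apply words_length|].
    exists I; intros w Hw; apply HI; now apply words_length. }
  destruct HI as [I HI]; exists M.
  apply Rle_trans with (bsum I (fun i => nu (c i))); [|rewrite <- sumR_seq; apply Hs].
  apply Rle_trans with (wsum M (fun w => bsum I (fun i => nu w * indic (cov i w)))).
  - apply wsum_le; intros w Hw.
    assert (Hpos : forall i, 0 <= nu w * indic (cov i w)).
    { intros i; apply Rmult_le_pos; [apply Hnu | apply indic_bound]. }
    destruct (classic (hit P w)) as [H|H].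
    + rewrite indic_false by tauto; rewrite Rmult_0_r; now apply bsum_nonneg.
    + destruct (HI w Hw H) as (i & Hi & Hci).
      rewrite (indic_true _ H), <- (indic_true _ Hci).
      apply (bsum_ge_term I (fun i => nu w * indic (cov i w))); auto.
  - rewrite wsum_bsum; apply bsum_le; intros i _.
    destruct (le_lt_dec (length (c i)) M) as [Hl|Hl].
    + rewrite (wsum_ext M _ (fun w => nu w * indic (firstn (length (c i)) w = c i))).
      * rewrite (wsum_firstn nu (length (c i)) M (fun u => indic (u = c i)) Hnu Hl).
        rewrite wsum_delta; lra.
      * intros w Hw; f_equal; unfold cov.
        destruct (classic (firstn (length (c i)) w = c i)); 
          [rewrite !indic_true | rewrite !indic_false]; try tauto; split; auto; lia.
    + rewrite (wsum_ext M _ (fun _ => 0)).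
      * rewrite wsum_const, Rmult_0_r; apply Hnu.
      * intros w Hw; rewrite indic_false; [lra|]; unfold cov; intros [H _]; lia.
Qed.

(** * Greedy tilings and the ergodic theorem *)

Definition mean (nu : list bool -> R) (n : nat) (f : list bool -> R) : R :=
  wsum n (fun w => nu w * f w).

Lemma mean_le nu n f g :
  prob_measure nu -> (forall w, length w = n -> f w <= g w) -> mean nu n f <= mean nu n g.
Proof.
  intros Hnu H; apply wsum_le; intros w Hw; apply Rmult_le_compat_l; [apply Hnu | auto].
Qed.

Lemma mean_affine nu n a b f :
  prob_measure nu -> mean nu n (fun w => a * f w + b) = a * mean nu n f + b.
Proof.
  intros Hnu; unfold mean.
  rewrite (wsum_ext n _ (fun w => a * (nu w * f w) + b * nu w)) by (intros; lra).
  rewrite wsum_plus, !wsum_scal, (total_mass nu n Hnu); lra.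
Qed.

Lemma mean_nonneg nu n f :
  prob_measure nu -> (forall w, length w = n -> 0 <= f w) -> 0 <= mean nu n f.
Proof. intros Hnu H; apply wsum_nonneg; intros w Hw; apply Rmult_le_pos; [apply Hnu | auto]. Qed.

(** A Birkhoff sum for a function of [k] coordinates, restricted to windows that fit inside [w];
    this restriction makes it superadditive for nonnegative [f]. *)
Fixpoint occ (k : nat) (f : list bool -> R) (w : list bool) : R :=
  match w with
  | [] => 0
  | _ :: w' => (if (k <=? length w)%nat then f (firstn k w) else 0) + occ k f w'
  end.

Lemma occ_nonneg k f w : (forall u, 0 <= f u) -> 0 <= occ k f w.
Proof.
  intros Hf; induction w as [|a w IH]; cbn [occ]; [lra|].
  destruct (k <=? length (a :: w))%nat; [specialize (Hf (firstn k (a :: w)))|]; lra.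
Qed.

Lemma occ_superadditive k f u v :
  (forall w, 0 <= f w) -> occ k f u + occ k f v <= occ k f (u ++ v).
Proof.
  intros Hf; induction u as [|a u IH]; cbn [occ app]; [lra|].
  destruct (k <=? length (a :: u))%nat eqn:E.
  - apply Nat.leb_le in E; rewrite app_comm_cons, (proj2 (Nat.leb_le _ _))
      by (rewrite length_app; lia).
    rewrite firstn_app; replace (k - length (a :: u))%nat with O by lia.
    rewrite firstn_O, app_nil_r; lra.
  - destruct (k <=? length (a :: u ++ v))%nat; [specialize (Hf (firstn k (a :: u ++ v)))|]; lra.
Qed.

(** By stationarity each window has mean [mean nu k f], and at most [n] windows fit. *)
Lemma mean_occ_le nu k f n :
  prob_measure nu -> stationary nu -> (forall w, 0 <= f w) ->
  mean nu n (occ k f) <= INR n * mean nu k f.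
Proof.
  intros Hnu Hst Hf.
  assert (Hk : 0 <= mean nu k f) by (apply mean_nonneg; auto).
  induction n as [|n IH]; [unfold mean; simpl; lra|].
  rewrite S_INR.
  assert (E : mean nu (S n) (occ k f) =
    wsum (S n) (fun w => nu w * (if (k <=? S n)%nat then f (firstn k w) else 0)) + mean nu n (occ k f)).
  { transitivity (wsum (S n) (fun w => nu w * (if (k <=? S n)%nat then f (firstn k w) else 0)) +
                  wsum (S n) (fun w => nu w * occ k f (tl w))).
    - rewrite <- wsum_plus; apply wsum_ext; intros [|a w] Hw; [discriminate|].
      cbn [occ tl]; rewrite Hw; lra.
    - f_equal; cbn [wsum tl]; rewrite <- wsum_plus; apply wsum_ext; intros w _.
      rewrite (Hst w); lra. }
  rewrite E; destruct (k <=? S n)%nat eqn:Hkn.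
  - apply Nat.leb_le in Hkn; rewrite (wsum_firstn nu k (S n) f Hnu Hkn); unfold mean in *; lra.
  - rewrite (wsum_ext (S n) _ (fun _ => 0)) by (intros; lra); rewrite wsum_const; lra.
Qed.

Definition tile (Phi : list bool -> R) (c : R) (w : list bool) : Prop :=
  w <> [] /\ Phi w <= c * INR (length w).

(** Reading from the left, a prefix that is a tile is cut off at cost [c] per letter; otherwise one
    letter is removed at cost [C], charged to the window of length [M] starting there, which has no
    tile as a prefix. The term [Rabs c] covers negative [c], as in the application to occurrence
    counts. *)
Lemma tile_bound Phi c C M w :
  (forall u v, Phi (u ++ v) <= Phi u + Phi v) ->
  (forall u, Phi u <= C * INR (length u)) -> 0 <= C ->
  Phi w <= c * INR (length w) +
           (C + Rabs c) * (occ M (fun u => indic (~ hit (tile Phi c) u)) w + INR M).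
Proof.
  intros Hsub HC HC0.
  set (f := fun u => indic (~ hit (tile Phi c) u)).
  assert (Hf : forall u, 0 <= f u) by (intros; apply indic_bound).
  assert (Hc := Rle_abs c); assert (Hc' := Rle_abs (- c)); rewrite Rabs_Ropp in Hc'.
  assert (Hc0 := Rabs_pos c); set (b := Rabs c) in *; clearbody b.
  remember (length w) as n eqn:Hn; revert w Hn.
  induction n as [n IH] using lt_wf_ind; intros w Hn.
  assert (Ho := occ_nonneg M f w Hf).
  destruct (le_lt_dec M (length w)) as [HM|HM].
  (* Fewer than [M] letters remain, and the constant term in [INR M] pays for them. *)
  2: { assert (INR (length w) <= INR M) by (apply le_INR; lia).
       assert (0 <= INR (length w)) by apply pos_INR.
       specialize (HC w); rewrite <- Hn in *; nra. }
  destruct (classic (hit (tile Phi c) w)) as [Hh|Hh];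
  [destruct (classic (hit (tile Phi c) (firstn M w))) as [Hm|Hm]|].
  - destruct Hh as (m & Hm1 & Hm2 & Hm3).
    assert (Hsplit := firstn_skipn m w).
    assert (Hl : length (firstn m w) = m) by (rewrite length_firstn; lia).
    assert (Hm0 : (0 < m)%nat) by (destruct m; [now destruct Hm2 | lia]).
    assert (Hsl : length (skipn m w) = (n - m)%nat) by (rewrite length_skipn; lia).
    specialize (IH (n - m)%nat ltac:(lia) (skipn m w) (eq_sym Hsl)).
    assert (Hs := Hsub (firstn m w) (skipn m w)).
    assert (Hocc := occ_superadditive M f (firstn m w) (skipn m w) Hf).
    assert (Ho1 := occ_nonneg M f (firstn m w) Hf).
    rewrite Hsplit in Hs, Hocc; rewrite Hl in Hm3; rewrite minus_INR in IH by lia.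
    nra.
  - destruct w as [|a w]; [exfalso; apply Hm; now rewrite firstn_nil|].
    assert (Hs := Hsub [a] w); assert (HCa := HC [a]); simpl in Hs, HCa.
    simpl in Hn; specialize (IH (length w) ltac:(lia) w eq_refl).
    cbn [occ]; rewrite (proj2 (Nat.leb_le _ _) HM).
    unfold f at 1; rewrite (indic_true _ Hm); fold f.
    rewrite Hn, S_INR; nra.
  - destruct w as [|a w].
    { assert (H := HC []); rewrite Hn; simpl in *; assert (0 <= INR M) by apply pos_INR; nra. }
    assert (Hm : ~ hit (tile Phi c) (firstn M (a :: w))).
    { intros H; apply Hh; rewrite <- (firstn_skipn M (a :: w)); now apply hit_app. }
    assert (Hs := Hsub [a] w); assert (HCa := HC [a]); simpl in Hs, HCa.
    simpl in Hn; specialize (IH (length w) ltac:(lia) w eq_refl).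
    cbn [occ]; rewrite (proj2 (Nat.leb_le _ _) HM).
    unfold f at 1; rewrite (indic_true _ Hm); fold f.
    rewrite Hn, S_INR; nra.
Qed.

Lemma subadditive_mean nu Phi c C eps :
  prob_measure nu -> stationary nu ->
  (forall u v, Phi (u ++ v) <= Phi u + Phi v) ->
  (forall u, Phi u <= C * INR (length u)) -> 0 <= C ->
  almost_surely nu (fun x => exists n, (0 < n)%nat /\ Phi (prefix x n) <= c * INR n) ->
  0 < eps ->
  exists D, forall N, mean nu N Phi <= (c + eps) * INR N + D.
Proof.
  intros Hnu Hst Hsub HC HC0 Has He.
  set (K := C + Rabs c); assert (HK : 0 <= K) by (unfold K; pose proof (Rabs_pos c); lra).
  (* Each untiled window is charged [K], so density [eps / (K + 1)] costs at most [eps] per letter;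
     the [+ 1] guards against [K = 0]. *)
  assert (Hd : 0 < eps / (K + 1)) by (apply Rdiv_lt_0_compat; lra).
  destruct (full_open nu _ (tile Phi c) (eps / (K + 1)) Hnu Has) as [M HM]; [|easy|].
  { intros x (n & Hn & H); exists n; split; [|now rewrite prefix_length].
    intros E; apply (f_equal (@length bool)) in E; rewrite prefix_length in E; simpl in E; lia. }
  set (f := fun u => indic (~ hit (tile Phi c) u)) in *.
  exists (K * INR M); intros N.
  assert (Hocc := mean_occ_le nu M f N Hnu Hst (fun w => proj1 (indic_bound _))).
  fold (mean nu M f) in HM.
  apply Rle_trans with (mean nu N (fun w => K * occ M f w + (c * INR N + K * INR M))).
  - apply mean_le; [easy|]; intros w Hw.
    pose proof (tile_bound Phi c C M w Hsub HC HC0) as H; rewrite Hw in H; fold K f in H; lra.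
  - rewrite (mean_affine nu N K _ (occ M f) Hnu).
    assert (H1 : K * (eps / (K + 1)) <= eps).
    { apply Rle_trans with ((K + 1) * (eps / (K + 1))); [nra|]; right; field; lra. }
    assert (H2 : INR N * mean nu M f <= INR N * (eps / (K + 1)))
      by (apply Rmult_le_compat_l; [apply pos_INR | easy]).
    assert (H3 : K * mean nu N (occ M f) <= K * (INR N * (eps / (K + 1))))
      by (apply Rmult_le_compat_l; [easy | lra]).
    pose proof (pos_INR N); nra.
Qed.

(** * Borel events defined by prefixes *)

Lemma borel_true : borel (fun _ => True).
Proof. apply borel_ext with (1 := borel_cyl []); intros x; simpl; tauto. Qed.

Lemma borel_false : borel (fun _ => False).
Proof. apply borel_ext with (1 := borel_compl _ borel_true); tauto. Qed.

Lemma borel_or (A B : bseq -> Prop) : borel A -> borel B -> borel (fun x => A x \/ B x).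
Proof.
  intros HA HB.
  apply borel_ext with (fun x => exists i : nat, match i with O => A | _ => B end x).
  - apply borel_cunion; now intros [|i].
  - intros x; split; [intros [[|i] H]; auto | intros [H|H]; [now exists O | now exists 1%nat]].
Qed.

Lemma borel_forall (F : nat -> bseq -> Prop) :
  (forall i, borel (F i)) -> borel (fun x => forall i, F i x).
Proof.
  intros H; apply borel_ext with (fun x => ~ exists i, ~ F i x).
  - apply borel_compl, borel_cunion; intros i; now apply borel_compl.
  - intros x; split; [intros Hx i; apply NNPP; eauto | intros Hx [i Hi]; auto].
Qed.

(** There are finitely many words of length [n], so even an arbitrary [P] gives a finite union of
    cylinders. *)
Lemma borel_prefix n (P : list bool -> Prop) : borel (fun x => P (prefix x n)).
Proof.
  assert (G : forall l, borel (fun x => exists w, In w l /\ P w /\ prefix x (length w) = w)).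
  { induction l as [|w l IH].
    - apply borel_ext with (1 := borel_false); intros x; split; [tauto | now intros (w & [] & _)].
    - destruct (classic (P w)) as [Hw|Hw].
      + apply borel_ext with (1 := borel_or _ _ (borel_cyl w) IH); intros x; split.
        * intros [H|(v & H1 & H2)]; [exists w | exists v]; simpl; auto.
        * intros (v & [<-|H1] & H2 & H3); [now left | right; eauto].
      + apply borel_ext with (1 := IH); intros x; split.
        * intros (v & H1 & H2); exists v; simpl; auto.
        * intros (v & [<-|H1] & H2 & H3); [contradiction | eauto]. }
  apply borel_ext with (1 := G (words n)); intros x; split.
  - intros (w & Hw & HP & E); apply words_length in Hw; rewrite Hw in E; now rewrite E.
  - intros H; exists (prefix x n); rewrite words_length, prefix_length; auto.
Qed.

Definition infinitely_often (P : nat -> Prop) : Prop :=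
  forall n0, exists n, (n0 <= n)%nat /\ P n.

Definition for_all_large (P : nat -> Prop) : Prop :=
  exists n0, forall n, (n0 <= n)%nat -> P n.

Lemma not_for_all_large P : ~ for_all_large P -> infinitely_often (fun n => ~ P n).
Proof.
  intros H n0; apply NNPP; intros Hn; apply H; exists n0; intros n Hn0.
  apply NNPP; intros HP; apply Hn; eauto.
Qed.

Lemma borel_io (P : nat -> list bool -> Prop) :
  borel (fun x => infinitely_often (fun n => P n (prefix x n))).
Proof.
  apply borel_forall; intros n0.
  apply (borel_cunion (fun n x => (n0 <= n)%nat /\ P n (prefix x n))); intros n.
  apply (borel_prefix n (fun w => (n0 <= n)%nat /\ P n w)).
Qed.

Lemma wsum_bounded_on n (f : list bool -> R) :
  exists F, 0 <= F /\ forall w, length w = n -> f w <= F.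
Proof.
  exists (wsum n (fun w => Rabs (f w))); split.
  - apply wsum_nonneg; intros; apply Rabs_pos.
  - intros w Hw; apply Rle_trans with (Rabs (f w)); [apply Rle_abs|].
    apply (wsum_ge_term n (fun w => Rabs (f w))); [intros; apply Rabs_pos | easy].
Qed.

(** If the invariant event [A] had full measure, almost every sequence would have a prefix with
    occurrence density nearly [alpha] or more; tiling by such prefixes would push the mean count
    above what stationarity allows. *)
Lemma ergodic_upper nu k f alpha :
  prob_measure nu -> stationary nu -> ergodic nu ->
  (forall w, 0 <= f w) -> mean nu k f < alpha ->
  almost_surely nu (fun x => for_all_large (fun n => occ k f (prefix x n) <= alpha * INR n)).
Proof.
  intros Hnu Hst Herg Hf Hal.
  assert (Hal0 : 0 < alpha) by (pose proof (mean_nonneg nu k f Hnu (fun w _ => Hf w)); lra).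
  (* The slack [C] makes [A] exactly shift invariant. *)
  set (A := fun x => exists C : nat, infinitely_often
              (fun n => alpha * INR n - INR C <= occ k f (prefix x n))).
  assert (HB : borel A).
  { apply borel_cunion; intros C.
    exact (borel_io (fun n w => alpha * INR n - INR C <= occ k f w)). }
  assert (HI : forall x, A x <-> A (shift x)).
  { destruct (wsum_bounded_on k f) as (F & HF0 & HF).
    assert (Hstep : forall x n, occ k f (prefix (shift x) n) <= occ k f (prefix x (S n))
                                <= F + occ k f (prefix (shift x) n)).
    { intros x n; rewrite prefix_S; cbn [occ].
      destruct (k <=? _)%nat eqn:E; [|lra]; apply Nat.leb_le in E.
      specialize (Hf (firstn k (x O :: prefix (shift x) n))).
      specialize (HF (firstn k (x O :: prefix (shift x) n))).
      rewrite length_firstn in HF; specialize (HF ltac:(lia)); lra. }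
    intros x; split; intros [C H].
    - destruct (INR_unbounded F) as [F' HF'].
      exists (C + F')%nat; intros n0; destruct (H (S n0)) as (n & Hn & Ho).
      destruct n as [|n]; [lia|]; exists n; split; [lia|].
      specialize (Hstep x n); rewrite plus_INR; rewrite S_INR in Ho; lra.
    - destruct (INR_unbounded alpha) as [F' HF'].
      exists (C + F')%nat; intros n0; destruct (H n0) as (n & Hn & Ho).
      exists (S n); split; [lia|].
      specialize (Hstep x n); rewrite plus_INR, S_INR; lra. }
  destruct (Herg A HB HI) as [H0|H1].
  - apply null_incl with (2 := H0); intros x Hx; exists O; intros n0.
    destruct (not_for_all_large _ Hx n0) as (n & Hn & Ho).
    exists n; split; [easy | simpl; lra].
  - exfalso.
    (* One third of the gap absorbs the slack [C], one is lost in the tiling lemma, and the last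
       outgrows the constant [D]. *)
    set (e := (alpha - mean nu k f) / 3).
    assert (He : 0 < e) by (unfold e; lra).
    destruct (subadditive_mean nu (fun w => - occ k f w) (- (alpha - e)) 0 e) as [D HD]; try easy.
    + intros u v; pose proof (occ_superadditive k f u v Hf); lra.
    + intros u; pose proof (occ_nonneg k f u Hf); lra.
    + apply as_impl with (2 := H1); intros x [C HC].
      destruct (INR_unbounded (INR C / e)) as [m Hm].
      destruct (HC (S m)) as (n & Hn & Ho); exists n; split; [lia|].
      assert (INR m <= INR n) by (apply le_INR; lia).
      assert (INR C < e * INR n).
      { apply Rmult_lt_reg_l with (/ e); [now apply Rinv_0_lt_compat|].
        rewrite <- Rmult_assoc, Rinv_l by lra; unfold Rdiv in Hm; lra. }
      lra.
    + destruct (INR_unbounded (D / e)) as [N HN]; specialize (HD N).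
      pose proof (mean_occ_le nu k f N Hnu Hst Hf) as Hup.
      assert (E : mean nu N (fun w => - occ k f w) = - mean nu N (occ k f)).
      { unfold mean; rewrite (wsum_ext _ _ (fun w => (-1) * (nu w * occ k f w))) by (intros; lra).
        rewrite wsum_scal; lra. }
      assert (D < e * INR N).
      { apply Rmult_lt_reg_l with (/ e); [now apply Rinv_0_lt_compat|].
        rewrite <- Rmult_assoc, Rinv_l by lra; unfold Rdiv in HN; lra. }
      assert (mean nu k f = alpha - 3 * e) by (unfold e; field).
      rewrite E in HD; nra.
Qed.

(** * Codes obtained by summing over parsings *)

Lemma ln2_pos : 0 < ln 2.
Proof. rewrite <- ln_1; apply ln_increasing; lra. Qed.

Lemma log2_mult x y : 0 < x -> 0 < y -> log2 (x * y) = log2 x + log2 y.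
Proof. intros; unfold log2; rewrite ln_mult by easy; pose proof ln2_pos; field; lra. Qed.

Lemma log2_le x y : 0 < x -> x <= y -> log2 x <= log2 y.
Proof.
  intros Hx Hy; apply Rmult_le_compat_r; [left; apply Rinv_0_lt_compat, ln2_pos|].
  destruct Hy as [Hy| ->]; [left; now apply ln_increasing | lra].
Qed.

Lemma log2_1 : log2 1 = 0.
Proof. unfold log2; rewrite ln_1; lra. Qed.

Lemma log2_2 : log2 2 = 1.
Proof. pose proof ln2_pos; unfold log2; field; lra. Qed.

Lemma log2_inv x : 0 < x -> log2 (/ x) = - log2 x.
Proof. intros; unfold log2; rewrite ln_Rinv by easy; pose proof ln2_pos; field; lra. Qed.

Lemma log2_pow x n : 0 < x -> log2 (x ^ n) = INR n * log2 x.
Proof. intros; unfold log2; rewrite ln_pow by easy; pose proof ln2_pos; field; lra. Qed.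

Lemma log2_half_pow n : log2 ((/ 2) ^ n) = - INR n.
Proof. rewrite log2_pow, log2_inv, log2_2 by lra; lra. Qed.

Lemma log2_quarter_pow n : log2 ((/ 4) ^ n) = - (2 * INR n).
Proof.
  replace (/ 4) with ((/ 2) ^ 2) by (simpl; lra).
  rewrite <- pow_mult, log2_half_pow, mult_INR; simpl; lra.
Qed.

Lemma ln_le_sub_1 t : 0 < t -> ln t <= t - 1.
Proof. intros Ht; pose proof (exp_ineq1_le (ln t)); rewrite exp_ln in *; lra. Qed.

(** The reciprocals telescope and have sum 1/2 over [m >= 1]: a prior on the token length that costs
    logarithmically many bits. *)
Definition overhead (m : nat) : R := (INR m + 1) * (INR m + 2).

Lemma overhead_pos m : 0 < overhead m.
Proof. unfold overhead; pose proof (pos_INR m); nra. Qed.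

Lemma overhead_sublinear eps :
  0 < eps -> exists C, 0 <= C /\ forall m, log2 (overhead m) <= eps * INR m + C.
Proof.
  intros He; pose proof ln2_pos as H2.
  (* The tangent bound [ln t <= d * t - 1 - ln d] is applied to both factors of [overhead]; each
     contributes slope [d], half of [eps] in natural logarithms. *)
  set (d := eps * ln 2 / 2); assert (Hd : 0 < d) by (unfold d; nra).
  assert (Hb : forall m, log2 (overhead m) <= eps * INR m + 2 * (2 * d - 1 - ln d) / ln 2).
  { intros m; pose proof (pos_INR m) as Hm; unfold log2, overhead; rewrite ln_mult by lra.
    assert (E : forall t, 0 < t -> ln t <= d * t - 1 - ln d).
    { intros t Ht; pose proof (ln_le_sub_1 (d * t) ltac:(nra)) as H.
      rewrite ln_mult in H by easy; lra. }
    pose proof (E (INR m + 1) ltac:(lra)); pose proof (E (INR m + 2) ltac:(lra)).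
    apply Rmult_le_reg_r with (ln 2); [easy|].
    replace ((eps * INR m + 2 * (2 * d - 1 - ln d) / ln 2) * ln 2)
      with (2 * (d * INR m) + 2 * (2 * d - 1 - ln d)) by (unfold d; field; lra).
    unfold Rdiv at 1; rewrite Rmult_assoc, Rinv_l by lra; lra. }
  exists (Rabs (2 * (2 * d - 1 - ln d) / ln 2)); split; [apply Rabs_pos|].
  intros m; specialize (Hb m); pose proof (Rle_abs (2 * (2 * d - 1 - ln d) / ln 2)); lra.
Qed.

(** The mass is bounded on each length separately, which is why tokens will carry a prior on their
    length. *)
Definition subprob (beta : list bool -> R) : Prop :=
  (forall w, 0 <= beta w) /\ forall n, wsum n beta <= 1.

(* The total weight of the factorizations of [u ++ w] into tokens of weight [d]
   whose first token is strictly longer than [u] (and is [u] when both are empty). *)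
Fixpoint parse (d : list bool -> R) (u w : list bool) : R :=
  match w with
  | [] => match u with [] => 1 | _ => 0 end
  | a :: w' => parse d (u ++ [a]) w' + d (u ++ [a]) * parse d [] w'
  end.

Lemma parse_nonneg d u w : (forall v, 0 <= d v) -> 0 <= parse d u w.
Proof.
  intros Hd; revert u; induction w as [|a w IH]; intros u; cbn [parse].
  - destruct u; lra.
  - pose proof (IH (u ++ [a])); pose proof (IH []); pose proof (Hd (u ++ [a])); nra.
Qed.

Lemma parse_supermultiplicative d u w1 w2 :
  (forall v, 0 <= d v) -> parse d u w1 * parse d [] w2 <= parse d u (w1 ++ w2).
Proof.
  intros Hd; revert u; induction w1 as [|a w IH]; intros u; cbn [parse app].
  - destruct u; [lra|]; rewrite Rmult_0_l; now apply parse_nonneg.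
  - pose proof (IH (u ++ [a])); pose proof (IH []); pose proof (Hd (u ++ [a])); nra.
Qed.

Lemma parse_ge_token d u w : (forall v, 0 <= d v) -> w <> [] -> d (u ++ w) <= parse d u w.
Proof.
  intros Hd; revert u; induction w as [|a [|b w] IH]; intros u Hw; [easy| |].
  - simpl; destruct (u ++ [a]); lra.
  - pose proof (IH (u ++ [a]) ltac:(easy)) as H; rewrite <- app_assoc in H; cbn [app] in H.
    pose proof (parse_nonneg d [] (b :: w) Hd); pose proof (Hd (u ++ [a])).
    change (parse d u (a :: b :: w))
      with (parse d (u ++ [a]) (b :: w) + d (u ++ [a]) * parse d [] (b :: w)); nra.
Qed.

(** Split by the length of the first token: what follows it has total weight at most 1. The last
    hypothesis excludes the empty factorization, of weight 1. *)
Lemma parse_sum_le d n u :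
  (forall v, 0 <= d v) -> (forall m, (m < n)%nat -> wsum m (parse d []) <= 1) ->
  u <> [] \/ (0 < n)%nat ->
  wsum n (parse d u) <= bsum n (fun j => wsum (S j) (fun v => d (u ++ v))).
Proof.
  intros Hd; revert u; induction n as [|n IH]; intros u Hn Hu.
  - destruct Hu as [Hu|Hu]; [|lia]; destruct u; simpl; [easy | lra].
  - assert (Hpart : forall a, wsum n (fun w => parse d u (a :: w)) <=
      bsum n (fun j => wsum (S j) (fun v => d (u ++ a :: v))) + d (u ++ [a])).
    { intros a; cbn [parse]; rewrite wsum_plus, wsum_scal; apply Rplus_le_compat.
      - eapply Rle_trans; [apply IH|].
        + intros m Hm; apply Hn; lia.
        + left; now destruct u.
        + right; apply bsum_ext; intros j _; apply wsum_ext; intros v _.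
          now rewrite <- app_assoc.
      - pose proof (Hd (u ++ [a])); pose proof (Hn n ltac:(lia)); nra. }
    pose proof (Hpart false) as H0; pose proof (Hpart true) as H1.
    rewrite bsum_S_first; change (wsum (S n) (parse d u))
      with (wsum n (fun w => parse d u (false :: w)) + wsum n (fun w => parse d u (true :: w))).
    assert (E : bsum n (fun j => wsum (S (S j)) (fun v => d (u ++ v))) =
      bsum n (fun j => wsum (S j) (fun v => d (u ++ false :: v))) +
      bsum n (fun j => wsum (S j) (fun v => d (u ++ true :: v)))).
    { rewrite <- bsum_plus; apply bsum_ext; intros j _; reflexivity. }
    rewrite E; change (wsum 1 (fun v => d (u ++ v))) with (d (u ++ [false]) + d (u ++ [true])); lra.
Qed.

(** Kraft's inequality for concatenated tokens: the first token is nonempty, so strong induction on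
    the length handles the rest. *)
Lemma parse_kraft d :
  (forall v, 0 <= d v) -> (forall n, bsum n (fun j => wsum (S j) d) <= 1) ->
  forall n, wsum n (parse d []) <= 1.
Proof.
  intros Hd Hs n; induction n as [n IH] using lt_wf_ind.
  destruct n as [|n]; [simpl; lra|].
  eapply Rle_trans; [apply parse_sum_le; auto; right; lia | apply Hs].
Qed.

(** Half of the token budget goes to the two single letters, so that every word can be parsed; the
    other half goes to [beta]. *)
Definition dict (beta : list bool -> R) (w : list bool) : R :=
  (if (length w =? 1)%nat then / 4 else 0) + / overhead (length w) * beta w.

(** Parsings of two words concatenate, so this weight is supermultiplicative and [cost], the ideal
    code length in bits, is subadditive, as the tiling lemma demands. *)
Definition code (beta : list bool -> R) : list bool -> R := parse (dict beta) [].

Definition cost (beta : list bool -> R) (w : list bool) : R := - log2 (code beta w).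

Section Code.

Variable beta : list bool -> R.
Hypothesis Hbeta : subprob beta.

Lemma dict_nonneg w : 0 <= dict beta w.
Proof.
  unfold dict; apply Rplus_le_le_0_compat; [destruct (_ =? _)%nat; lra|].
  apply Rmult_le_pos; [left; apply Rinv_0_lt_compat, overhead_pos | apply Hbeta].
Qed.

Lemma code_subprob : subprob (code beta).
Proof.
  split; [intros w; apply parse_nonneg, dict_nonneg|].
  apply parse_kraft; [apply dict_nonneg|]; intros n.
  assert (H : bsum n (fun j => wsum (S j) (dict beta)) <=
              (if (n =? 0)%nat then 0 else / 2) + (/ 2 - / (INR n + 2))).
  { induction n as [|n IH]; [simpl; lra|]; cbn [bsum].
    assert (Hn : wsum (S n) (dict beta) <= (if (n =? 0)%nat then / 2 else 0) + / overhead (S n)).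
    { apply Rle_trans with (wsum (S n) (fun w =>
        (if (n =? 0)%nat then / 4 else 0) + / overhead (S n) * beta w)).
      - apply wsum_le; intros w Hw; unfold dict; rewrite Hw; simpl; lra.
      - rewrite wsum_plus, wsum_const, wsum_scal; apply Rplus_le_compat.
        + destruct n; simpl; lra.
        + assert (H := proj2 Hbeta (S n)).
          assert (0 < / overhead (S n)) by apply Rinv_0_lt_compat, overhead_pos; nra. }
    assert (Ho : / overhead (S n) = / (INR n + 2) - / (INR (S n) + 2)).
    { unfold overhead; rewrite S_INR; pose proof (pos_INR n); field; lra. }
    destruct n; simpl (_ =? _)%nat in *; lra. }
  assert (0 < / (INR n + 2)) by (pose proof (pos_INR n); apply Rinv_0_lt_compat; lra).
  destruct (n =? 0)%nat; lra.
Qed.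

Lemma code_le_1 w : code beta w <= 1.
Proof.
  apply Rle_trans with (2 := proj2 code_subprob (length w)).
  apply wsum_ge_term; [intros; apply code_subprob | easy].
Qed.

Lemma code_supermultiplicative u v : code beta u * code beta v <= code beta (u ++ v).
Proof. apply parse_supermultiplicative, dict_nonneg. Qed.

(** Parsing letter by letter makes every weight positive and the cost at most 2 bits per letter. *)
Lemma code_ge_letters w : (/ 4) ^ length w <= code beta w.
Proof.
  induction w as [|a w IH]; [unfold code; simpl; lra|].
  apply Rle_trans with (2 := code_supermultiplicative [a] w).
  assert (Ha : / 4 <= code beta [a]).
  { apply Rle_trans with (dict beta [a]); [|now apply (parse_ge_token _ []); [apply dict_nonneg|]].
    unfold dict; simpl length; simpl Nat.eqb.
    assert (0 <= / overhead 1 * beta [a]); [|lra].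
    apply Rmult_le_pos; [left; apply Rinv_0_lt_compat, overhead_pos | apply Hbeta]. }
  simpl pow; apply Rmult_le_compat; try lra; apply pow_le; lra.
Qed.

Lemma code_pos w : 0 < code beta w.
Proof. apply Rlt_le_trans with (2 := code_ge_letters w); apply pow_lt; lra. Qed.

Lemma code_ge w : w <> [] -> / overhead (length w) * beta w <= code beta w.
Proof.
  intros Hw; apply Rle_trans with (dict beta w).
  - unfold dict; destruct (_ =? _)%nat; lra.
  - apply (parse_ge_token _ []); [apply dict_nonneg | easy].
Qed.

Lemma cost_nonneg w : 0 <= cost beta w.
Proof.
  pose proof (log2_le _ _ (code_pos w) (code_le_1 w)); rewrite log2_1 in *; unfold cost; lra.
Qed.

Lemma cost_subadditive u v : cost beta (u ++ v) <= cost beta u + cost beta v.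
Proof.
  pose proof (code_pos u); pose proof (code_pos v).
  assert (H1 : log2 (code beta u * code beta v) <= log2 (code beta (u ++ v)))
    by (apply log2_le; [nra | apply code_supermultiplicative]).
  rewrite log2_mult in H1 by easy; unfold cost; lra.
Qed.

Lemma cost_le_letters w : cost beta w <= 2 * INR (length w).
Proof.
  assert (H := log2_le _ _ (pow_lt (/ 4) (length w) ltac:(lra)) (code_ge_letters w)).
  rewrite log2_quarter_pow in H; unfold cost; lra.
Qed.

Lemma cost_le w b :
  w <> [] -> 0 < b -> b <= beta w -> cost beta w <= - log2 b + log2 (overhead (length w)).
Proof.
  intros Hw Hb0 Hb.
  assert (Ho := overhead_pos (length w)); assert (Ho' := Rinv_0_lt_compat _ Ho).
  assert (H : log2 (/ overhead (length w) * b) <= log2 (code beta w)).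
  { apply log2_le; [nra|]; apply Rle_trans with (2 := code_ge w Hw); nra. }
  rewrite log2_mult, log2_inv in H by easy; unfold cost; lra.
Qed.

End Code.

(** Nonnegativity of relative entropy, from [ln t <= t - 1] at [t = Q w / nu w]. *)
Lemma gibbs nu Q n :
  prob_measure nu -> (forall w, 0 < Q w) -> wsum n Q <= 1 ->
  - wsum n (fun w => xlog2x (nu w)) <= mean nu n (fun w => - log2 (Q w)).
Proof.
  intros Hnu HQ HS; pose proof ln2_pos as H2; assert (H2' := Rinv_0_lt_compat _ H2).
  assert (H : wsum n (fun w => / ln 2 * nu w + (- / ln 2) * Q w) <=
              wsum n (fun w => nu w * - log2 (Q w) + xlog2x (nu w))).
  { apply wsum_le; intros w _; specialize (HQ w); unfold xlog2x.
    destruct (Req_EM_T (nu w) 0) as [->|Hw]; [nra|].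
    assert (Hw0 : 0 < nu w) by (destruct (proj1 (proj2 Hnu) w); lra).
    assert (Hl : ln (Q w) <= ln (nu w) + (Q w / nu w - 1)).
    { assert (0 < Q w / nu w) by now apply Rdiv_lt_0_compat.
      replace (Q w) with (nu w * (Q w / nu w)) at 1 by (field; lra).
      rewrite ln_mult by easy; pose proof (ln_le_sub_1 (Q w / nu w)); lra. }
    assert (nu w * ln (Q w) <= nu w * ln (nu w) + (Q w - nu w)).
    { replace (Q w - nu w) with (nu w * (Q w / nu w - 1)) by (field; lra); nra. }
    unfold log2, Rdiv; nra. }
  rewrite !wsum_plus, !wsum_scal, (total_mass nu n Hnu) in H; unfold mean; nra.
Qed.

(* [drop_mix] and [pad_mix] keep total mass at most 1 on each length while giving [w] a positive
   proportion of the weight of any word obtained from [w] by deleting, respectively inserting,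
   initial letters. *)
Fixpoint drop_mix (beta : list bool -> R) (w : list bool) : R :=
  match w with
  | [] => beta []
  | _ :: w' => / 2 * beta w + / 4 * drop_mix beta w'
  end.

Lemma drop_mix_nonneg beta w : (forall v, 0 <= beta v) -> 0 <= drop_mix beta w.
Proof.
  intros H; induction w as [|a w IH]; cbn [drop_mix]; [apply H|].
  specialize (H (a :: w)); lra.
Qed.

(** The factor [/ 4] shares one half between the two words that have the same tail. *)
Lemma drop_mix_subprob beta : subprob beta -> subprob (drop_mix beta).
Proof.
  intros [H0 HS]; split; [intros w; now apply drop_mix_nonneg|].
  induction n as [|n IH]; [exact (HS O)|].
  cbn [wsum drop_mix]; rewrite !wsum_plus, !wsum_scal.
  specialize (HS (S n)); cbn [wsum] in HS; lra.
Qed.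

Lemma drop_mix_ge beta k w :
  (forall v, 0 <= beta v) -> (k <= length w)%nat ->
  (/ 4) ^ k * / 2 * beta (skipn k w) <= drop_mix beta w.
Proof.
  intros H0; revert w; induction k as [|k IH]; intros [|a w] Hk; simpl in Hk; try lia;
    cbn [skipn pow drop_mix].
  - specialize (H0 []); lra.
  - pose proof (drop_mix_nonneg beta w H0); lra.
  - specialize (IH w ltac:(lia)); specialize (H0 (a :: w)); lra.
Qed.

(** The word grows along this recursion, hence the explicit bound [L] on the number of inserted
    letters. *)
Fixpoint pad_upto (beta : list bool -> R) (L : nat) (v : list bool) : R :=
  match L with
  | O => beta v
  | S L' => / 2 * beta v + / 2 * (pad_upto beta L' (false :: v) + pad_upto beta L' (true :: v))
  end.

Definition pad_mix (beta : list bool -> R) (v : list bool) : R := pad_upto beta (length v) v.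

Lemma pad_upto_nonneg beta L v : (forall w, 0 <= beta w) -> 0 <= pad_upto beta L v.
Proof.
  intros H; revert v; induction L as [|L IH]; intros v; cbn [pad_upto]; [apply H|].
  pose proof (IH (false :: v)); pose proof (IH (true :: v)); specialize (H v); lra.
Qed.

Lemma pad_mix_subprob beta : subprob beta -> subprob (pad_mix beta).
Proof.
  intros [H0 HS]; split; [intros w; now apply pad_upto_nonneg|].
  assert (H : forall L n, wsum n (pad_upto beta L) <= 1).
  { induction L as [|L IH]; intros n; [apply HS|].
    cbn [pad_upto]; rewrite wsum_plus, !wsum_scal, wsum_plus.
    specialize (IH (S n)); cbn [wsum] in IH; specialize (HS n); lra. }
  intros n; apply Rle_trans with (2 := H n n); right; apply wsum_ext.
  intros w Hw; unfold pad_mix; now rewrite Hw.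
Qed.

Lemma pad_mix_ge beta u v :
  (forall w, 0 <= beta w) -> (length u <= length v)%nat ->
  (/ 2) ^ S (length u) * beta (u ++ v) <= pad_mix beta v.
Proof.
  intros H0; unfold pad_mix; generalize (length v) as L; intros L; revert L v.
  (* Letters are inserted at the front, so the last letter of [u] comes first. *)
  induction u as [|a u IH] using rev_ind; intros L v Hu.
  - pose proof (H0 v); destruct L as [|L]; cbn [pad_upto app length pow]; [lra|].
    pose proof (pad_upto_nonneg beta L (false :: v) H0).
    pose proof (pad_upto_nonneg beta L (true :: v) H0); lra.
  - rewrite length_app in *; simpl in Hu; destruct L as [|L]; [lia|].
    specialize (IH L (a :: v) ltac:(lia)); rewrite <- app_assoc; cbn [app].
    replace (length u + length [a])%nat with (S (length u)) by (simpl; lia).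
    cbn [pow pad_upto] in *; pose proof (H0 v).
    pose proof (pad_upto_nonneg beta L (false :: v) H0).
    pose proof (pad_upto_nonneg beta L (true :: v) H0); destruct a; lra.
Qed.

(** * Sets of words growing slower than the entropy *)

Lemma log2_Rpower y : log2 (Rpower 2 y) = y.
Proof. unfold log2, Rpower; rewrite ln_exp; pose proof ln2_pos; field; lra. Qed.

Lemma entropy_rate_words nu n :
  INR (S n) * block_entropy_rate nu (S n) = - wsum (S n) (fun w => xlog2x (nu w)).
Proof.
  unfold block_entropy_rate; rewrite sumR_words.
  assert (INR (S n) <> 0) by (apply not_0_INR; lia); field; easy.
Qed.

Lemma large_ge_multiple e C : 0 < e -> exists N, forall n, (N <= n)%nat -> C <= e * INR n.
Proof.
  intros He; destruct (INR_unbounded (C / e)) as [N HN]; exists N; intros n Hn.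
  apply le_INR in Hn; apply Rmult_le_reg_l with (/ e); [now apply Rinv_0_lt_compat|].
  rewrite <- Rmult_assoc, Rinv_l by lra; unfold Rdiv in HN; lra.
Qed.

Lemma slow_sets_rare nu h c (B : list bool -> Prop) :
  prob_measure nu -> stationary nu -> ergodic nu ->
  Un_cv (fun n => block_entropy_rate nu (S n)) h -> 0 <= c < h ->
  (forall n, wsum n (fun w => indic (B w)) <= 2 * Rpower 2 (c * INR n)) ->
  almost_surely nu (fun x => for_all_large (fun n => ~ B (prefix x n))).
Proof.
  intros Hnu Hst Herg Hh Hc HB.
  (* Closing [B] under deleting and inserting initial segments of bounded length makes the set of
     sequences that visit it infinitely often exactly shift invariant. *)
  set (A := fun x => exists k l : nat, infinitely_often (fun n =>
              exists u, length u = l /\ B (u ++ skipn k (prefix x n)))).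
  assert (HA : borel A).
  { apply borel_cunion; intros k; apply borel_cunion; intros l.
    exact (borel_io (fun n w => exists u, length u = l /\ B (u ++ skipn k w))). }
  assert (HI : forall x, A x <-> A (shift x)).
  { intros x; split.
    - intros (k & l & H).
      destruct k as [|k]; [exists O, (S l) | exists k, l]; intros n0;
        destruct (H (S n0)) as (n & Hn & u & Hu & Hw); (destruct n as [|n]; [lia|]);
        rewrite prefix_S in Hw; exists n; (split; [lia|]).
      + exists (u ++ [x O]); rewrite <- app_assoc; split; [rewrite length_app; simpl; lia | easy].
      + now exists u.
    - intros (k & l & H); exists (S k), l; intros n0.
      destruct (H n0) as (n & Hn & Hw); exists (S n); split; [lia|].
      now rewrite prefix_S. }
  destruct (Herg A HA HI) as [H0|H1].
  { apply null_incl with (2 := H0); intros x Hx; exists O, O; intros n0.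
    destruct (not_for_all_large _ Hx n0) as (n & Hn & Hw); exists n; split; [easy|].
    exists []; split; [easy | now apply NNPP]. }
  exfalso.
  (* Naming a word of [B] of length [n] takes [c * n + 1] bits; the division by 2 offsets the factor
     2 in the growth bound for [B]. *)
  set (b0 := fun w => indic (B w) * (Rpower 2 (- (c * INR (length w))) / 2)).
  assert (Hp : forall y, 0 < Rpower 2 y) by (intros; apply exp_pos).
  assert (Hb0 : subprob b0).
  { split.
    - intros w; pose proof (indic_bound (B w)); pose proof (Hp (- (c * INR (length w)))).
      unfold b0; apply Rmult_le_pos; lra.
    - intros n.
      rewrite (wsum_ext n _ (fun w => (Rpower 2 (- (c * INR n)) / 2) * indic (B w)))
        by (intros w Hw; unfold b0; rewrite Hw; lra).
      rewrite wsum_scal; specialize (HB n); pose proof (Hp (- (c * INR n))).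
      assert (Hm : Rpower 2 (- (c * INR n)) * Rpower 2 (c * INR n) = 1).
      { rewrite <- Rpower_plus, Rplus_opp_l; apply Rpower_O; lra. }
      nra. }
  assert (Hpad := pad_mix_subprob b0 Hb0).
  set (beta := drop_mix (pad_mix b0)).
  assert (Hbeta : subprob beta) by now apply drop_mix_subprob.
  (* The quarters of the gap go to the excess cost of a tile, the tiling lemma, the convergence of
     the entropy rate and the constant [D]. *)
  set (e := (h - c) / 4); assert (He : 0 < e) by (unfold e; lra).
  destruct (subadditive_mean nu (cost beta) (c + e) 2 e Hnu Hst) as [D HD]; try lra.
  - now apply cost_subadditive.
  - intros u; now apply cost_le_letters.
  - apply as_impl with (2 := H1); intros x (k & l & Hx).
    destruct (overhead_sublinear (e / 2) ltac:(lra)) as (C & HC0 & HC).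
    (* Bits for one visit beyond [c * n]: [2k + 1] for the deletion, [l + 1] for the insertion, 1
       for the halving in [b0], [c * l] for the inserted letters and [C] from the overhead, whose
       linear part takes the other [e / 2]. *)
    destruct (large_ge_multiple (e / 2) (2 * INR k + INR l + 3 + c * INR l + C) ltac:(lra)) as [N HN].
    (* So late a visit leaves at least [l] letters after deleting [k], as [pad_mix_ge] requires. *)
    destruct (Hx (N + k + l + 1)%nat) as (n & Hn & u & Hu & Hw).
    exists n; split; [lia|].
    set (w := prefix x n) in *; assert (Hlw : length w = n) by apply prefix_length.
    assert (Hsk : length (skipn k w) = (n - k)%nat) by (rewrite length_skipn; lia).
    pose proof (drop_mix_ge (pad_mix b0) k w (proj1 Hpad) ltac:(lia)) as G1.
    pose proof (pad_mix_ge b0 u (skipn k w) (proj1 Hb0) ltac:(lia)) as G2.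
    unfold b0 at 1 in G2; rewrite (indic_true _ Hw), Hu, length_app, Hsk, Hu, Rmult_1_l in G2.
    set (y := - (c * INR (l + (n - k)))) in *.
    assert (P1 : 0 < (/ 4) ^ k) by (apply pow_lt; lra).
    assert (P2 : 0 < (/ 2) ^ S l) by (apply pow_lt; lra).
    pose proof (Hp y) as P3.
    assert (Hc2 : cost beta w <=
      - log2 ((/ 4) ^ k * / 2 * ((/ 2) ^ S l * (Rpower 2 y * / 2))) + log2 (overhead (length w))).
    { apply cost_le; [easy| | |].
      - intros E; rewrite E in Hlw; simpl in Hlw; lia.
      - repeat apply Rmult_lt_0_compat; first [apply pow_lt; lra | lra].
      - apply Rle_trans with (2 := G1); apply Rmult_le_compat_l; [nra | exact G2]. }
    assert (P4 : 0 < Rpower 2 y * / 2) by nra.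
    rewrite !log2_mult in Hc2 by (try easy; try lra; nra).
    rewrite log2_quarter_pow, log2_half_pow, log2_Rpower, log2_inv, log2_2, S_INR, Hlw in Hc2 by lra.
    specialize (HC n); specialize (HN n ltac:(lia)).
    assert (- y <= c * INR l + c * INR n).
    { unfold y; rewrite Ropp_involutive, <- Rmult_plus_distr_l, <- plus_INR.
      apply Rmult_le_compat_l; [lra | apply le_INR; lia]. }
    lra.
  - destruct (Hh e He) as [N1 HN1].
    destruct (large_ge_multiple e (D + 1) He) as [N2 HN2].
    set (n := (N1 + N2)%nat).
    specialize (HN1 n ltac:(lia)); specialize (HN2 (S n) ltac:(lia)); specialize (HD (S n)).
    unfold Rdist in HN1; apply Rabs_def2 in HN1.
    pose proof (gibbs nu (code beta) (S n) Hnu (code_pos beta Hbeta)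
                  (proj2 (code_subprob beta Hbeta) (S n))) as G.
    rewrite <- entropy_rate_words in G.
    change (mean nu (S n) (fun w => - log2 (code beta w))) with (mean nu (S n) (cost beta)) in G.
    assert (0 < INR (S n)) by (apply lt_0_INR; lia).
    assert (E : h = c + 4 * e) by (unfold e; field).
    assert (INR (S n) * (c + 3 * e) < INR (S n) * block_entropy_rate nu (S n))
      by (apply Rmult_lt_compat_l; lra).
    lra.
Qed.

(** * A countable family of codes reaching the entropy *)

(** The least exponent with [(/ 2) ^ l <= y] works. Integer code lengths make the block models
    countable and let ties in the ranking be broken. *)
Lemma dyadic_approx : exists L : R -> nat, forall y, 0 < y <= 1 -> y / 2 <= (/ 2) ^ L y <= y.
Proof.
  assert (H : forall y, exists l : nat, 0 < y <= 1 -> y / 2 <= (/ 2) ^ l <= y).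
  { intros y; destruct (classic (0 < y <= 1)) as [Hy|Hy]; [|exists O; tauto].
    destruct (pow_lt_1_zero (/ 2) ltac:(rewrite Rabs_right; lra) y ltac:(lra)) as [N HN].
    specialize (HN N (le_n N)).
    assert (Hle : (/ 2) ^ N <= y) by (pose proof (Rle_abs ((/ 2) ^ N)); lra).
    clear HN; induction N as [|N IH].
    - exists O; simpl in *; lra.
    - destruct (Rle_lt_dec ((/ 2) ^ N) y) as [Hl|Hl]; [now apply IH|].
      exists (S N); simpl in *; lra. }
  exists (fun y => proj1_sig (constructive_indefinite_description _ (H y))).
  intros y; exact (proj2_sig (constructive_indefinite_description _ (H y))).
Qed.

Definition block_prob (k : nat) (l : list bool -> nat) (w : list bool) : R :=
  if (length w =? k)%nat then (/ 2) ^ l w / wsum k (fun v => (/ 2) ^ l v) else 0.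

Lemma half_pow_pos n : 0 < (/ 2) ^ n.
Proof. apply pow_lt; lra. Qed.

Lemma block_sum_pos k l : 0 < wsum k (fun v => (/ 2) ^ l v).
Proof.
  apply Rlt_le_trans with ((/ 2) ^ l (repeat false k)); [apply half_pow_pos|].
  apply (wsum_ge_term k (fun v => (/ 2) ^ l v)); [|apply repeat_length].
  intros v _; left; apply half_pow_pos.
Qed.

Lemma block_prob_subprob k l : subprob (block_prob k l).
Proof.
  pose proof (block_sum_pos k l) as HZ; split.
  - intros w; unfold block_prob; destruct (_ =? _)%nat; [|lra].
    left; apply Rdiv_lt_0_compat; [apply half_pow_pos | easy].
  - intros n; destruct (Nat.eqb_spec n k) as [->|Hn].
    + rewrite (wsum_ext k _ (fun w => / wsum k (fun v => (/ 2) ^ l v) * (/ 2) ^ l w)).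
      * rewrite wsum_scal, Rinv_l; lra.
      * intros w Hw; unfold block_prob; rewrite Hw, Nat.eqb_refl; unfold Rdiv; lra.
    + rewrite (wsum_ext n _ (fun _ => 0)); [rewrite wsum_const; lra|].
      intros w Hw; unfold block_prob; rewrite Hw; now apply Nat.eqb_neq in Hn as ->.
Qed.

(* As [j] runs over [nat], [table k j] runs over all functions from words of length [k] to [nat]. *)
Fixpoint table (k j : nat) (w : list bool) : nat :=
  match k, w with
  | O, _ => j
  | S _, [] => O
  | S k', a :: w' => table k' (if a then fst (of_nat j) else snd (of_nat j)) w'
  end.

Lemma table_surjective k (l : list bool -> nat) :
  exists j, forall w, length w = k -> table k j w = l w.
Proof.
  revert l; induction k as [|k IH]; intros l.
  - exists (l []); intros [|a w] Hw; [reflexivity | discriminate].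
  - destruct (IH (fun w => l (true :: w))) as [j1 H1], (IH (fun w => l (false :: w))) as [j0 H0].
    exists (to_nat (j1, j0)); intros [|a w] [= Hw]; cbn [table]; rewrite cancel_of_to.
    destruct a; [now apply H1 | now apply H0].
Qed.

Definition model (j : nat) : list bool -> R :=
  block_prob (fst (of_nat j)) (table (fst (of_nat j)) (snd (of_nat j))).

Lemma model_subprob j : subprob (model j).
Proof. apply block_prob_subprob. Qed.

(** Passing to the tail of a word replaces the term at the word by the term at its suffix after [k]
    letters; by subadditivity the loss is at most [Phi] of the first window. *)
Lemma phase_sum_le Phi k w :
  (forall u v, Phi (u ++ v) <= Phi u + Phi v) ->
  (forall u, 0 <= Phi u <= 2 * INR (length u)) -> (0 < k)%nat ->
  bsum k (fun s => Phi (skipn s w)) <= occ k Phi w + 2 * INR k * INR k.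
Proof.
  intros Hsub HPhi Hk.
  assert (Hshort : forall w, (length w < k)%nat ->
            bsum k (fun s => Phi (skipn s w)) <= occ k Phi w + 2 * INR k * INR k).
  { intros v Hv; apply Rle_trans with (bsum k (fun _ => 2 * INR k)).
    - apply bsum_le; intros s _; apply Rle_trans with (1 := proj2 (HPhi _)).
      apply Rmult_le_compat_l; [lra|]; apply le_INR; rewrite length_skipn; lia.
    - rewrite bsum_const; pose proof (occ_nonneg k Phi v (fun u => proj1 (HPhi u))); lra. }
  induction w as [|a w IH]; [now apply Hshort|].
  destruct (le_lt_dec k (length (a :: w))) as [Hl|Hl]; [|now apply Hshort].
  cbn [occ]; rewrite (proj2 (Nat.leb_le _ _) Hl).
  destruct k as [|k]; [lia|]; rewrite bsum_S_first; cbn [bsum skipn] in *.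
  pose proof (Hsub (firstn (S k) (a :: w)) (skipn (S k) (a :: w))) as H.
  rewrite firstn_skipn in H; cbn [skipn] in H; lra.
Qed.

(** Average over the [k] phases of cutting [w] into blocks: each phase discards fewer than [k]
    initial letters, at 2 bits per letter. *)
Lemma blocks_control Phi k w :
  (forall u v, Phi (u ++ v) <= Phi u + Phi v) ->
  (forall u, 0 <= Phi u <= 2 * INR (length u)) -> (0 < k)%nat ->
  INR k * Phi w <= occ k Phi w + 4 * INR k * INR k.
Proof.
  intros Hsub HPhi Hk; rewrite <- bsum_const.
  apply Rle_trans with (bsum k (fun s => 2 * INR k + Phi (skipn s w))).
  - apply bsum_le; intros s Hs.
    pose proof (Hsub (firstn s w) (skipn s w)) as H; rewrite firstn_skipn in H.
    pose proof (proj2 (HPhi (firstn s w))).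
    assert (INR (length (firstn s w)) <= INR k) by (apply le_INR; rewrite length_firstn; lia).
    lra.
  - rewrite bsum_plus, bsum_const; pose proof (phase_sum_le Phi k w Hsub HPhi Hk); lra.
Qed.

Lemma model_for_blocks nu k :
  prob_measure nu -> (0 < k)%nat ->
  exists j, forall w, length w = k -> nu w / 4 <= model j w.
Proof.
  intros Hnu Hk; destruct dyadic_approx as [L HL].
  (* Mixing with the uniform distribution keeps every weight positive. Mixing and rounding lose a
     factor 2 each, whence [nu w / 4]. *)
  set (y := fun w => (nu w + (/ 2) ^ k) / 2).
  assert (Hh : (/ 2) ^ k <= 1) by (rewrite <- (pow1 k); apply pow_incr; lra).
  assert (Hy : forall w, 0 < y w <= 1).
  { intros w; unfold y; pose proof (half_pow_pos k); pose proof (proj1 (proj2 Hnu) w).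
    assert (nu w <= 1); [|lra].
    rewrite <- (total_mass nu (length w) Hnu).
    apply wsum_ge_term; [intros; apply Hnu | easy]. }
  destruct (table_surjective k (fun w => L (y w))) as [i Hi].
  exists (to_nat (k, i)); unfold model; rewrite cancel_of_to.
  intros w Hw; cbn [fst snd]; unfold block_prob; rewrite Hw, Nat.eqb_refl.
  assert (HZ : wsum k (fun v => (/ 2) ^ table k i v) <= 1).
  { apply Rle_trans with (wsum k (fun v => / 2 * (nu v + (/ 2) ^ k))).
    - apply wsum_le; intros v Hv; rewrite Hi by easy.
      pose proof (HL (y v) (Hy v)); unfold y in *; lra.
    - rewrite wsum_scal, wsum_plus, wsum_const, (total_mass nu k Hnu).
      rewrite <- Rpow_mult_distr; replace (2 * / 2) with 1 by lra; rewrite pow1; lra. }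
  pose proof (block_sum_pos k (table k i)) as HZ0.
  apply Rle_trans with ((/ 2) ^ table k i w).
  - rewrite Hi by easy; pose proof (HL (y w) (Hy w)); pose proof (half_pow_pos k); unfold y in *; lra.
  - apply Rmult_le_reg_r with (wsum k (fun v => (/ 2) ^ table k i v)); [easy|].
    unfold Rdiv; rewrite Rmult_assoc, Rinv_l by lra.
    pose proof (half_pow_pos (table k i w)); nra.
Qed.

Lemma mean_block_cost nu k beta :
  prob_measure nu -> subprob beta -> (0 < k)%nat ->
  (forall w, length w = k -> nu w / 4 <= beta w) ->
  mean nu k (cost beta) <= - wsum k (fun w => xlog2x (nu w)) + 2 + log2 (overhead k).
Proof.
  intros Hnu Hbeta Hk Hb.
  apply Rle_trans with (wsum k (fun w => (-1) * xlog2x (nu w) + (2 + log2 (overhead k)) * nu w)).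
  - apply wsum_le; intros w Hw; unfold xlog2x.
    destruct (Req_EM_T (nu w) 0) as [->|Hn]; [lra|].
    assert (Hn0 : 0 < nu w) by (destruct (proj1 (proj2 Hnu) w); lra).
    assert (Hc : cost beta w <= - log2 (nu w / 4) + log2 (overhead (length w))).
    { apply cost_le; [easy | intros ->; simpl in Hw; lia | lra | now apply Hb]. }
    unfold Rdiv in Hc; rewrite log2_mult in Hc by lra.
    pose proof (log2_quarter_pow 1) as H4; rewrite pow_1 in H4; simpl INR in H4.
    rewrite H4, Hw in Hc; nra.
  - rewrite wsum_plus, !wsum_scal, (total_mass nu k Hnu); lra.
Qed.

(** A model close to [nu] on long blocks has mean block cost near [k * h]; the ergodic theorem
    carries this to the windows of a typical sequence, and [blocks_control] to its prefixes. *)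
Lemma models_reach_entropy nu h c :
  prob_measure nu -> stationary nu -> ergodic nu ->
  Un_cv (fun n => block_entropy_rate nu (S n)) h -> h < c ->
  exists j, almost_surely nu (fun x => for_all_large (fun n =>
              cost (model j) (prefix x n) <= c * INR n)).
Proof.
  intros Hnu Hst Herg Hh Hc.
  (* The entropy rate at the block length, the linear part of the overhead, the constants [2 + C]
     and the boundary term of [blocks_control] each lose at most [e] per letter. *)
  set (e := (c - h) / 5); assert (He : 0 < e) by (unfold e; lra).
  destruct (overhead_sublinear e He) as (C & HC0 & HC).
  destruct (Hh e He) as [N1 HN1]; destruct (large_ge_multiple e (2 + C) He) as [N2 HN2].
  set (n := (N1 + N2)%nat) in *; set (k := S n).
  specialize (HN1 n ltac:(lia)); specialize (HN2 k ltac:(lia)); specialize (HC k).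
  unfold Rdist in HN1; apply Rabs_def2 in HN1.
  destruct (model_for_blocks nu k Hnu ltac:(lia)) as [j Hm]; exists j.
  assert (Hmj := model_subprob j).
  assert (Hmean := mean_block_cost nu k (model j) Hnu Hmj ltac:(lia) Hm).
  assert (Hent := entropy_rate_words nu n); fold k in Hent, HN1; rewrite <- Hent in Hmean.
  assert (Hk : 0 < INR k) by (apply lt_0_INR; lia).
  assert (Hlt : mean nu k (cost (model j)) < INR k * (h + 4 * e)).
  { assert (INR k * block_entropy_rate nu k < INR k * (h + e))
      by (apply Rmult_lt_compat_l; lra).
    lra. }
  assert (Herg' := ergodic_upper nu k (cost (model j)) _ Hnu Hst Herg (cost_nonneg _ Hmj) Hlt).
  apply as_impl with (2 := Herg'); intros x [n0 Hx].
  destruct (large_ge_multiple e (4 * INR k) He) as [N3 HN3].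
  exists (n0 + N3)%nat; intros m Hm'.
  specialize (Hx m ltac:(lia)); specialize (HN3 m ltac:(lia)).
  pose proof (blocks_control (cost (model j)) k (prefix x m)
    (cost_subadditive _ Hmj) (fun u => conj (cost_nonneg _ Hmj u) (cost_le_letters _ Hmj u))
    ltac:(lia)) as Hb.
  assert (E : c = h + 5 * e) by (unfold e; field).
  apply Rmult_le_reg_l with (INR k); [easy|]; rewrite E; nra.
Qed.

(** A truncation of the infinite mixture: each code enters once [n] exceeds its index, which is
    enough asymptotically. *)
Definition univ (n : nat) (w : list bool) : R :=
  bsum n (fun j => (/ 2) ^ S j * code (model j) w).

Lemma univ_ge n j w : (j < n)%nat -> (/ 2) ^ S j * code (model j) w <= univ n w.
Proof.
  intros Hj; apply (bsum_ge_term n (fun j => (/ 2) ^ S j * code (model j) w)); [|easy].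
  intros i _; left; apply Rmult_lt_0_compat; [apply half_pow_pos | apply code_pos, model_subprob].
Qed.

Lemma univ_pos n w : 0 < univ (S n) w.
Proof.
  apply Rlt_le_trans with (2 := univ_ge (S n) O w ltac:(lia)).
  apply Rmult_lt_0_compat; [apply half_pow_pos | apply code_pos, model_subprob].
Qed.

Lemma univ_sum_le_1 n m : wsum m (univ n) <= 1.
Proof.
  unfold univ; rewrite wsum_bsum.
  apply Rle_trans with (bsum n (fun j => (/ 2) ^ S j)).
  - apply bsum_le; intros j _; rewrite wsum_scal.
    pose proof (half_pow_pos (S j)); pose proof (proj2 (code_subprob _ (model_subprob j)) m); nra.
  - rewrite bsum_half; pose proof (half_pow_pos n); lra.
Qed.

Lemma univ_le_1 n w : univ (S n) w <= 1.
Proof.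
  apply Rle_trans with (2 := univ_sum_le_1 (S n) (length w)).
  apply wsum_ge_term; [intros v _; left; apply univ_pos | easy].
Qed.

(** * Ranking words by their universal code *)

(* The word 0^(n-1) 1 gets the largest statistic: every sequence leaves these words, so that
   eventually the p-value is nonzero and its logarithm is not the junk value [ln 0 = 0]. *)
Definition top_word (n : nat) : list bool := repeat false (n - 1) ++ [true].

Lemma top_word_length n : (0 < n)%nat -> length (top_word n) = n.
Proof. intros H; unfold top_word; rewrite length_app, repeat_length; simpl; lia. Qed.

(** If [x p] is true, longer top words differ from [x] at [p]; if [x] has no 1, they differ in the
    last place. *)
Lemma prefix_leaves_top x : for_all_large (fun n => prefix x n <> top_word n).
Proof.
  assert (Hlast : forall n, prefix x (S n) = top_word (S n) ->
                    x n = true /\ forall i, (i < n)%nat -> x i = false).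
  { intros n H; rewrite prefix_S_last in H; unfold top_word in H.
    replace (S n - 1)%nat with n in H by lia.
    apply app_inj_tail in H as [H1 H2]; split; [easy|]; intros i Hi.
    apply (f_equal (fun l => nth i l (x O))) in H1; unfold prefix in H1.
    rewrite map_nth, seq_nth in H1 by easy; cbn [Nat.add] in H1; rewrite H1.
    rewrite (nth_indep _ _ false) by now rewrite repeat_length.
    apply nth_repeat. }
  destruct (classic (exists p, x p = true)) as [[p Hp]|Hno].
  - exists (S (S p)); intros [|n] Hn H; [lia|].
    destruct (Hlast n H) as [_ Hf]; rewrite Hf in Hp by lia; discriminate.
  - exists 1%nat; intros [|n] Hn H; [lia|]; destruct (Hlast n H) as [Ht _]; eauto.
Qed.

Fixpoint binary_value (w : list bool) : nat :=
  match w with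
  | [] => O
  | a :: w' => ((if a then 1 else 0) + 2 * binary_value w')%nat
  end.

Lemma binary_value_lt w : (binary_value w < 2 ^ length w)%nat.
Proof. induction w as [|[] w IH]; simpl; lia. Qed.

Lemma binary_value_inj u v : length u = length v -> binary_value u = binary_value v -> u = v.
Proof.
  revert v; induction u as [|a u IH]; intros [|b v] Hl H; try discriminate; [easy|].
  injection Hl as Hl; cbn [binary_value] in H.
  destruct a, b; try lia; f_equal; apply IH; lia.
Qed.

(** Lexicographic order: rounded code length first, ties broken by [binary_value], which is below
    [2 ^ n]. *)
Definition code_rank (L : R -> nat) (n : nat) (w : list bool) : nat :=
  (L (univ n w) * 2 ^ n + binary_value w)%nat.

(** Shorter codes must score higher, hence the sign; all words but the top one score at most 0. *)
Definition statistic (L : R -> nat) (n : nat) (w : list bool) : R :=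
  if list_eq_dec Bool.bool_dec w (top_word n) then 1 else - INR (code_rank L n w).

Lemma statistic_top L n : statistic L n (top_word n) = 1.
Proof. unfold statistic; now destruct (list_eq_dec _ _ _). Qed.

Lemma statistic_other L n w : w <> top_word n -> statistic L n w = - INR (code_rank L n w).
Proof. intros H; unfold statistic; now destruct (list_eq_dec _ _ _). Qed.

Lemma code_rank_inj L n u v :
  length u = n -> length v = n -> code_rank L n u = code_rank L n v -> u = v.
Proof.
  intros Hu Hv H; apply binary_value_inj; [lia|].
  pose proof (binary_value_lt u); pose proof (binary_value_lt v); rewrite Hu, Hv in *.
  unfold code_rank in H; rewrite !(Nat.mul_comm _ (2 ^ n)) in H.
  now apply (Nat.div_mod_unique (2 ^ n)) in H.
Qed.

Lemma statistic_inj L n u v :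
  length u = n -> length v = n -> statistic L n u = statistic L n v -> u = v.
Proof.
  intros Hu Hv; unfold statistic.
  pose proof (pos_INR (code_rank L n u)); pose proof (pos_INR (code_rank L n v)).
  destruct (list_eq_dec _ u _) as [->|_], (list_eq_dec _ v _) as [->|_]; intros E; try lra; [easy|].
  apply (code_rank_inj L n); auto; apply INR_eq; lra.
Qed.

Lemma statistic_lt L n u v :
  length u = n -> u <> top_word n -> v <> top_word n ->
  statistic L n u < statistic L n v -> (L (univ n v) <= L (univ n u))%nat.
Proof.
  intros Hu Hu' Hv'; rewrite !statistic_other by easy; intros H.
  assert (Hr : (code_rank L n v < code_rank L n u)%nat) by (apply INR_lt; lra).
  pose proof (binary_value_lt u); rewrite Hu in *; unfold code_rank in Hr; nia.
Qed.

Definition rank (tau : nat -> list bool -> R) (n : nat) (u : list bool) : R :=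
  wsum n (fun y => indic (tau n u < tau n y)).

Lemma pvalue_rank tau n u : pvalue tau n u = rank tau n u / 2 ^ n.
Proof.
  unfold pvalue, rank; rewrite wsum_filter; f_equal; apply wsum_ext; intros y _.
  destruct (Rlt_dec _ _); [rewrite indic_true | rewrite indic_false]; easy.
Qed.

Lemma minimal_word n (f : list bool -> R) (P : list bool -> Prop) w :
  length w = n -> P w ->
  exists v, length v = n /\ P v /\ forall y, length y = n -> P y -> f v <= f y.
Proof.
  intros Hw HP.
  assert (G : forall l, (exists v, In v l /\ P v) ->
            exists v, In v l /\ P v /\ forall y, In y l -> P y -> f v <= f y).
  { induction l as [|a l IH]; [now intros (v & [] & _)|]; intros Hex.
    destruct (classic (exists v, In v l /\ P v)) as [Hl|Hl].
    - destruct (IH Hl) as (v & H1 & H2 & H3).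
      destruct (classic (P a /\ f a < f v)) as [[Ha Hlt]|Hn].
      + exists a; split; [now left|]; split; [easy|]; intros y [<-|Hy] HPy; [lra|].
        specialize (H3 y Hy HPy); lra.
      + exists v; split; [now right|]; split; [easy|]; intros y [<-|Hy] HPy; [|auto].
        apply Rnot_lt_le; intros Hlt; auto.
    - destruct Hex as (v & [->|Hv] & Hp); [|exfalso; eauto].
      exists v; split; [now left|]; split; [easy|]; intros y [<-|Hy] HPy; [lra | exfalso; eauto]. }
  destruct (G (words n)) as (v & H1 & H2 & H3); [exists w; now rewrite words_length|].
  exists v; split; [now apply words_length|]; split; [easy|].
  intros y Hy; apply H3; now apply words_length.
Qed.

(** Let [v] have the least statistic among the words of rank below [r]. By injectivity the others
    lie strictly above [v] and are counted by its rank; [v] itself adds 1. *)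
Lemma rank_lt_count tau n r :
  (forall u v, length u = n -> length v = n -> tau n u = tau n v -> u = v) -> 0 <= r ->
  wsum n (fun w => indic (rank tau n w < r)) <= r + 1.
Proof.
  intros Hinj Hr.
  destruct (classic (exists w, length w = n /\ rank tau n w < r)) as [(w & Hw & Hlt)|Hno].
  - destruct (minimal_word n (tau n) (fun w => rank tau n w < r) w Hw Hlt) as (v & Hv & Hvr & Hmin).
    apply Rle_trans with (wsum n (fun y => indic (tau n v < tau n y) + 1 * indic (y = v))).
    + apply wsum_le; intros y Hy.
      pose proof (indic_bound (tau n v < tau n y)); pose proof (indic_bound (y = v)).
      destruct (classic (rank tau n y < r)) as [Hy'|Hy'];
        [rewrite (indic_true _ Hy') | rewrite (indic_false _ Hy'); lra].
      specialize (Hmin y Hy Hy').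
      destruct (classic (y = v)) as [E|E]; [rewrite (indic_true _ E); lra|].
      assert (Hs : tau n v < tau n y).
      { destruct Hmin as [|Heq]; [easy|]; exfalso; apply E; symmetry; now apply Hinj. }
      rewrite (indic_true _ Hs); lra.
    + rewrite wsum_plus; fold (rank tau n v).
      assert (E := wsum_delta (fun _ => 1) v); rewrite Hv in E; rewrite E; lra.
  - rewrite (wsum_ext n _ (fun _ => 0)); [rewrite wsum_const; lra|].
    intros w Hw; apply indic_false; eauto.
Qed.

Section Statistic.

Variable L : R -> nat.
Hypothesis HL : forall y, 0 < y <= 1 -> y / 2 <= (/ 2) ^ L y <= y.

Lemma rank_ge_1 n u :
  (0 < n)%nat -> u <> top_word n -> 1 <= rank (statistic L) n u.
Proof.
  intros Hn Hu.
  assert (Ht : statistic L n u < statistic L n (top_word n)).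
  { rewrite statistic_top, statistic_other by easy; pose proof (pos_INR (code_rank L n u)); lra. }
  rewrite <- (indic_true _ Ht).
  apply (wsum_ge_term n (fun y => indic (statistic L n u < statistic L n y)));
    [intros; apply indic_bound | now apply top_word_length].
Qed.

(** A word above [u], other than the top word, has a rounded code that is no longer, hence at least
    half the weight of [u]. Total weight 1 leaves room for [2 / univ (S n) u] of them, and the top
    word adds 1. *)
Lemma rank_le n u :
  length u = S n -> u <> top_word (S n) -> rank (statistic L) (S n) u <= 3 / univ (S n) u.
Proof.
  intros Hu Hu'; set (q := univ (S n)).
  assert (Hq : forall w, 0 < q w <= 1) by (intros; split; [apply univ_pos | apply univ_le_1]).
  assert (Hqu := Hq u); assert (Hi : 0 < / q u) by (apply Rinv_0_lt_compat; lra).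
  assert (Hi1 : 1 <= / q u) by (rewrite <- Rinv_1; apply Rinv_le_contravar; lra).
  apply Rle_trans with (wsum (S n) (fun y => 1 * indic (y = top_word (S n)) + 2 * / q u * q y)).
  - apply wsum_le; intros y Hy.
    pose proof (indic_bound (y = top_word (S n))); assert (Hqy := Hq y).
    assert (Hpos : 0 <= 2 * / q u * q y) by nra.
    destruct (classic (statistic L (S n) u < statistic L (S n) y)) as [Hlt|Hlt];
      [rewrite (indic_true _ Hlt) | rewrite (indic_false _ Hlt); lra].
    destruct (classic (y = top_word (S n))) as [E|E]; [rewrite (indic_true _ E); lra|].
    assert (Hll := statistic_lt L (S n) u y Hu Hu' E Hlt); fold q in Hll.
    assert (Hpow : (/ 2) ^ L (q u) <= (/ 2) ^ L (q y)).
    { replace (L (q u)) with (L (q y) + (L (q u) - L (q y)))%nat by lia; rewrite pow_add.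
      pose proof (half_pow_pos (L (q y))).
      assert ((/ 2) ^ (L (q u) - L (q y)) <= 1)
        by (rewrite <- (pow1 (L (q u) - L (q y))); apply pow_incr; lra).
      nra. }
    pose proof (HL (q u) Hqu); pose proof (HL (q y) Hqy).
    assert (Hone : / q u * q u = 1) by (apply Rinv_l; lra).
    rewrite (indic_false _ E); nra.
  - rewrite wsum_plus, (wsum_scal _ (2 * / q u)).
    assert (E := wsum_delta (fun _ => 1) (top_word (S n))).
    rewrite top_word_length in E by lia; rewrite E.
    pose proof (univ_sum_le_1 (S n) (S n)) as Hs; fold q in Hs; unfold Rdiv; nra.
Qed.

(** Code [j] has weight [(/ 2) ^ S j] in the mixture, costing [INR j + 1] bits; 2 more pay for the
    constant 3, rounded up to 4. *)
Lemma rank_log_le n j u :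
  length u = S n -> u <> top_word (S n) -> (j < S n)%nat ->
  log2 (rank (statistic L) (S n) u) <= cost (model j) u + (INR j + 3).
Proof.
  intros Hu Hu' Hj.
  pose proof (rank_ge_1 (S n) u ltac:(lia) Hu') as H1; pose proof (rank_le n u Hu Hu') as H3.
  pose proof (univ_pos n u) as Hq.
  pose proof (code_pos (model j) (model_subprob j) u) as Hc.
  apply Rle_trans with (log2 (4 * / univ (S n) u)).
  { apply log2_le; [lra|]; unfold Rdiv in H3; pose proof (Rinv_0_lt_compat _ Hq); lra. }
  rewrite log2_mult, log2_inv by (try apply Rinv_0_lt_compat; lra).
  assert (H4 : log2 4 = 2) by (replace 4 with (2 * 2) by lra; rewrite log2_mult, log2_2 by lra; lra).
  assert (Hl : log2 ((/ 2) ^ S j * code (model j) u) <= log2 (univ (S n) u)).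
  { apply log2_le; [apply Rmult_lt_0_compat; [apply half_pow_pos | easy] | now apply univ_ge]. }
  rewrite log2_mult, log2_half_pow, S_INR in Hl by (try apply half_pow_pos; easy).
  unfold cost; lra.
Qed.

End Statistic.

Theorem theorem1 :
  exists tau : nat -> list bool -> R,
    forall nu : list bool -> R,
      prob_measure nu -> stationary nu -> ergodic nu ->
      forall h : R,
        Un_cv (fun n => block_entropy_rate nu (S n)) h ->
        almost_surely nu (fun x =>
          Un_cv (fun n => - / INR (S n) * log2 (pvalue tau (S n) (prefix x (S n))))
                (1 - h)).
Proof.
  destruct dyadic_approx as [L HL]; exists (statistic L).
  intros nu Hnu Hst Herg h Hh.
  set (lr := fun x n => log2 (rank (statistic L) n (prefix x n))).
  assert (Hnn : forall w, 0 <= nu w) by apply Hnu.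
  assert (Hpos : forall i, 0 < / (INR i + 1))
    by (intros i; pose proof (pos_INR i); apply Rinv_0_lt_compat; lra).
  (* The tolerances [1 / (i + 1)] reduce the limit to countably many almost sure events. *)
  assert (Hup : almost_surely nu (fun x => forall i : nat,
            for_all_large (fun n => lr x n <= (h + / (INR i + 1)) * INR n))).
  { apply as_forall; [easy|]; intros i; specialize (Hpos i); set (e := / (INR i + 1)) in *.
    destruct (models_reach_entropy nu h (h + e / 2) Hnu Hst Herg Hh ltac:(lra)) as [j Hj].
    apply as_impl with (2 := Hj); intros x [n1 H1].
    destruct (prefix_leaves_top x) as [n2 H2].
    destruct (large_ge_multiple (e / 2) (INR j + 3) ltac:(lra)) as [n3 H3].
    exists (S (n1 + n2 + n3 + j)); intros [|n] Hn; [lia|].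
    specialize (H1 (S n) ltac:(lia)); specialize (H2 (S n) ltac:(lia)); specialize (H3 (S n) ltac:(lia)).
    pose proof (rank_log_le L HL n j (prefix x (S n)) (prefix_length _ _) H2 ltac:(lia)).
    unfold lr; lra. }
  assert (Hlow : almost_surely nu (fun x => forall i : nat,
            for_all_large (fun n => (h - / (INR i + 1)) * INR n <= lr x n))).
  { apply as_forall; [easy|]; intros i; specialize (Hpos i); set (e := / (INR i + 1)) in *.
    destruct (Rle_lt_dec 0 (h - e)) as [Hc|Hc].
    - set (c := h - e) in *.
      set (B := fun w => rank (statistic L) (length w) w < Rpower 2 (c * INR (length w))).
      assert (HB : forall n, wsum n (fun w => indic (B w)) <= 2 * Rpower 2 (c * INR n)).
      { intros n.
        (* Since [r >= 1], the count [r + 1] is at most [2 * r]. *)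
        assert (Hr : 1 <= Rpower 2 (c * INR n)).
        { rewrite <- (Rpower_O 2) by lra; apply Rle_Rpower; [lra|].
          apply Rmult_le_pos; [easy | apply pos_INR]. }
        apply Rle_trans with (Rpower 2 (c * INR n) + 1); [|lra].
        apply Rle_trans with (2 := rank_lt_count (statistic L) n (Rpower 2 (c * INR n))
                                (statistic_inj L n) ltac:(lra)).
        right; apply wsum_ext; intros w Hw; unfold B; now rewrite Hw. }
      pose proof (slow_sets_rare nu h c B Hnu Hst Herg Hh ltac:(unfold c in *; lra) HB) as Hs.
      apply as_impl with (2 := Hs); intros x [n0 Hx]; exists n0; intros n Hn.
      specialize (Hx n Hn); unfold B in Hx; rewrite prefix_length in Hx; apply Rnot_lt_le in Hx.
      rewrite <- (log2_Rpower (c * INR n)); apply log2_le; [apply exp_pos | easy].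
    (* For a negative exponent the bound holds along every sequence, as the rank is eventually at
       least 1; [Hup] supplies an almost sure event to start from. *)
    - apply as_impl with (2 := Hup); intros x _; destruct (prefix_leaves_top x) as [n0 H0].
      exists (S n0); intros n Hn.
      pose proof (rank_ge_1 L n (prefix x n) ltac:(lia) (H0 n ltac:(lia))) as H1.
      apply log2_le in H1; [|lra]; rewrite log2_1 in H1.
      pose proof (pos_INR n); unfold lr; nra. }
  apply as_impl with (2 := as_and nu _ _ Hnn Hup Hlow); intros x [Hu Hl] eps He.
  destruct (INR_unbounded (/ eps)) as [i Hi].
  assert (Hie : / (INR i + 1) < eps).
  { assert (0 < / eps) by now apply Rinv_0_lt_compat.
    rewrite <- (Rinv_inv eps); apply Rinv_lt_contravar; [|lra].
    apply Rmult_lt_0_compat; lra. }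
  destruct (Hu i) as [n1 H1], (Hl i) as [n2 H2], (prefix_leaves_top x) as [n3 H3].
  exists (n1 + n2 + n3)%nat; intros n Hn.
  specialize (H1 (S n) ltac:(lia)); specialize (H2 (S n) ltac:(lia)); specialize (H3 (S n) ltac:(lia)).
  pose proof (rank_ge_1 L (S n) (prefix x (S n)) ltac:(lia) H3) as Hr.
  assert (HS : 0 < INR (S n)) by (apply lt_0_INR; lia).
  (* The division by [2 ^ n] in the p-value produces the 1 in [1 - h]. *)
  assert (E : - / INR (S n) * log2 (pvalue (statistic L) (S n) (prefix x (S n))) - (1 - h) =
              h - lr x (S n) / INR (S n)).
  { rewrite pvalue_rank; unfold Rdiv at 1.
    rewrite log2_mult, log2_inv, log2_pow, log2_2 by
      (try (apply Rinv_0_lt_compat); try apply pow_lt; lra).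
    fold (lr x (S n)); field; lra. }
  unfold Rdist; rewrite E; apply Rabs_def1.
  - assert (h - / (INR i + 1) <= lr x (S n) / INR (S n)); [|lra].
    apply Rmult_le_reg_r with (INR (S n)); [easy|].
    unfold Rdiv; rewrite Rmult_assoc, Rinv_l by lra; lra.
  - assert (lr x (S n) / INR (S n) <= h + / (INR i + 1)); [|lra].
    apply Rmult_le_reg_r with (INR (S n)); [easy|].
    unfold Rdiv; rewrite (Rmult_assoc (lr x (S n))), Rinv_l by lra; lra.
Qed.
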